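(* Let $\alpha>0$ and $0<\beta<\frac12$. Consider the model $Y_i=f(x_i)+V^{1/2}(x_i)\xi_i$, $i=0,\dots,n$, $x_i=i/n$, with $\xi_0,\dots,\xi_n$ i.i.d. with distribution $P_\xi\in\Xi$. Let $\zeta=n^{-2\alpha}+n^{-\beta}+n^{-\frac{2\beta}{4\beta+1}}$ and let $\hat T$ be the kernel statistic defined in the context. Fix $\eta\in(0,1)$. Then there exist $C_\eta',C_\eta>0$ depending only on $\eta$ such that for all $C>C_\eta$, $$\sup_{f\in\mathcal{H}_\alpha,\,V\in\mathcal{D}_0,\,P_\xi\in\Xi}P_{f,V,P_\xi}(\hat T>C_\eta'\zeta^2)+\sup_{f\in\mathcal{H}_\alpha,\,V\in\mathcal{D}_{1,\beta}(C\zeta),\,P_\xi\in\Xi}P_{f,V,P_\xi}(\hat T\le C_\eta'\zeta^2)\le\eta .$$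
   Context: $\mathcal{H}_\alpha=\mathcal{H}_\alpha(M)$: functions $g:[0,1]\to\mathbb{R}$ with $|g^{(\lfloor\alpha\rfloor)}(x)-g^{(\lfloor\alpha\rfloor)}(y)|\le M|x-y|^{\alpha-\lfloor\alpha\rfloor}$ for all $x,y$ and $\|g^{(k)}\|_\infty\le M$ for $k=0,\dots,\lfloor\alpha\rfloor$; $M$ is a fixed sufficiently large constant. $\mathcal{D}_0=\{V:[0,1]\to[0,\infty):V(x_i)=\sigma^2\ \forall i\text{ for some }0\le\sigma^2\le M\}$; $\mathcal{D}_{1,\beta}(\varepsilon)=\{V\in\mathcal{H}_\beta:V\ge0,\ \sqrt{\frac1{n+1}\sum_{i=0}^n(V(x_i)-\bar V_n)^2}\ge\varepsilon\}$, $\bar V_n=\frac1{n+1}\sum_{i=0}^nV(x_i)$. $\Xi$ is the set of probability distributions $P_\xi$ with $E\xi=0$, $E\xi^2=1$, $E\xi^4\le C_\xi$ for $\xi\sim P_\xi$, $C_\xi$ a large universal constant. Kernel statistic: $K$ supported on $[-1,1]$, symmetric, bounded above and below by a universal constant, $\int_{-1}^1K=1$; $h=C_hn^{-(\frac2{4\beta+1}\wedge1)}$ with $C_h$ a sufficiently large universal constant; $R_i=Y_{i+1}-Y_i$ ($0\le i\le n-1$); $K_n^h(t)=\mathbb{1}_{\{|t|\ge2\}}\int_{|t|/n}^{(|t|+1)/n}\frac1hK(\frac uh)du\big/\big(1-\int_{-2/n}^{2/n}\frac1hK(\frac uh)du\big)$; $\hat T=\frac1n\sum_{0\le i,j\le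 n-1,|i-j|\ge2}K_n^h(i-j)R_i^2R_j^2-\frac1{n^2}\sum_{0\le i,j\le n-1,|i-j|\ge2}R_i^2R_j^2$. *)

(* Defs.v *)
From HB Require Import structures.
From mathcomp Require Import all_boot all_order all_algebra.
From mathcomp Require Import all_classical all_reals all_analysis.
Set Implicit Arguments. Unset Strict Implicit. Unset Printing Implicit Defensive.
Import Order.TTheory GRing.Theory Num.Theory.
Local Open Scope classical_set_scope.
Local Open Scope ring_scope.

Section Defs.
Variable R : realType.

(* Hoelder class H_alpha(M) on [0,1]; g is given on R, derivatives taken
   (two-sided) at the points of [0,1]. *)
Definition holder (alpha M : R) (g : R -> R) : Prop :=
  let m := Num.truncn alpha in
  (forall k : nat, (k < m)%N -> forall x, x \in `[0, 1] ->
      derivable (derive1n k g) x 1) /\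
  (forall k : nat, (k <= m)%N -> forall x, x \in `[0, 1] ->
      `|derive1n k g x| <= M) /\
  (forall x y, x \in `[0, 1] -> y \in `[0, 1] ->
      `|derive1n m g x - derive1n m g y| <= M * `|x - y| `^ (alpha - m%:R)).

Definition xpt (n i : nat) : R := i%:R / n%:R.

Definition D0 (M : R) (n : nat) (V : R -> R) : Prop :=
  (forall x, x \in `[0, 1] -> 0 <= V x) /\
  exists s2 : R, 0 <= s2 /\ s2 <= M /\ forall i : nat, (i <= n)%N -> V (xpt n i) = s2.

Definition Vbar (n : nat) (V : R -> R) : R :=
  (n.+1%:R)^-1 * \sum_(i < n.+1) V (xpt n i).

Definition D1 (beta M : R) (n : nat) (eps : R) (V : R -> R) : Prop :=
  holder beta M V /\ (forall x, x \in `[0, 1] -> 0 <= V x) /\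
  eps <= Num.sqrt ((n.+1%:R)^-1 * \sum_(i < n.+1) (V (xpt n i) - Vbar n V) ^+ 2).

Definition is_kernel (kl ku : R) (K : R -> R) : Prop :=
  measurable_fun setT K /\
  (forall x, 1 < `|x| -> K x = 0) /\
  (forall x, K (- x) = K x) /\
  (forall x, x \in `[-1, 1] -> kl <= K x <= ku) /\
  (\int[lebesgue_measure]_(x in `[(-1)%R, 1%R]) (K x)%:E = 1)%E.

Definition Kint (K : R -> R) (h a b : R) : R :=
  fine (\int[lebesgue_measure]_(u in `[a%R, b%R]) (h^-1 * K (u / h))%:E)%E.

Definition Knh (K : R -> R) (n : nat) (h : R) (t : R) : R :=
  if 2 <= `|t| then
    Kint K h (`|t| / n%:R) ((`|t| + 1) / n%:R) /
      (1 - Kint K h (- (2 / n%:R)) (2 / n%:R))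
  else 0.

Definition bandwidth (Ch beta : R) (n : nat) : R :=
  Ch * n%:R `^ (- Num.min (2 / (4 * beta + 1)) 1).

Definition zeta (alpha beta : R) (n : nat) : R :=
  n%:R `^ (- (2 * alpha)) + n%:R `^ (- beta) + n%:R `^ (- (2 * beta / (4 * beta + 1))).

Definition That (K : R -> R) (h : R) (n : nat) (y : nat -> R) : R :=
  let Rd (i : nat) := y i.+1 - y i in
  (n%:R)^-1 * \sum_(i < n) \sum_(j < n | (2 <= `|(i%:R : R) - j%:R|)%R)
      Knh K n h (i%:R - j%:R) * Rd i ^+ 2 * Rd j ^+ 2
  - (n%:R ^+ 2)^-1 * \sum_(i < n) \sum_(j < n | (2 <= `|(i%:R : R) - j%:R|)%R)
      Rd i ^+ 2 * Rd j ^+ 2.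

Definition Yobs (n : nat) (f V : R -> R) (Om : Type) (xi : 'I_n.+1 -> Om -> R)
    (w : Om) (i : nat) : R :=
  f (xpt n i) + Num.sqrt (V (xpt n i)) * xi (inord i) w.

Definition iid_noise (Cxi : R) d (Om : measurableType d) (P : probability Om R)
    (n : nat) (xi : 'I_n.+1 -> Om -> R) : Prop :=
  (forall i, measurable_fun setT (xi i)) /\
  (forall B : 'I_n.+1 -> set R, (forall i, measurable (B i)) ->
     fine (P (\bigcap_(i in [set: 'I_n.+1]) (xi i @^-1` B i)))
       = \prod_(i < n.+1) fine (P (xi i @^-1` B i))) /\
  (forall i (B : set R), measurable B -> P (xi i @^-1` B) = P (xi ord0 @^-1` B)) /\
  (\int[P]_w ((xi ord0 w) ^+ 4)%:E <= Cxi%:E)%E /\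
  (\int[P]_w (xi ord0 w)%:E = 0)%E /\
  (\int[P]_w ((xi ord0 w) ^+ 2)%:E = 1)%E.

End Defs.

(* Main.v *)
Require Import Defs.
From HB Require Import structures.
From mathcomp Require Import all_boot all_order all_algebra.
From mathcomp Require Import all_classical all_reals all_analysis.
From mathcomp Require Import measurable_realfun zify ring lra.
Import Order.TTheory GRing.Theory Num.Theory.
Import numFieldNormedType.Exports.
Local Open Scope classical_set_scope.
Local Open Scope ring_scope.

(* Write R_i for the increments of the observations, mu_i = E R_i^2 and
   Z_i = R_i^2 - mu_i.  The statistic is a quadratic form sum w_ij R_i^2 R_j^2
   supported on |i - j| >= 2, so that

     T = sum w_ij mu_i mu_j + (sum w_ij Z_i Z_j + 2 sum_i (sum_j w_ij mu_j) Z_i).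

   The rows of the kernel weights sum to 1 except within one bandwidth of the
   boundary; hence the first term equals the empirical variance v of the mu_i up
   to O(h + h^(2 beta) + 1/n) + (squared increments of f)^2, which is O(zeta^2).
   The Z_i are 1-dependent with bounded second moments, so in the second moment
   of the bracket only boundedly many terms per index survive, and it is
   O(zeta^4 + zeta^2 v).  Only fourth moments of the noise are needed: two
   factors Z_i Z_j at distance >= 2 are independent.  Under the null v is
   O(zeta^2), while under the alternative it is at least of order C^2 zeta^2;
   Chebyshev's inequality bounds both errors. *)

(** The final constants are chosen before [alpha], [beta] and [n], so every error is bounded by a
    power of [zeta] times a constant built from [Cxi], [ku], [M] and [Ch] alone. The three terms of
    [zeta] have separate jobs. The term n^(-2 alpha) bounds squared increments of f when alpha < 1;
    for alpha >= 1 these are O(n^-2), below n^(-beta). The other two terms are h^beta up to a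
    constant, in the regimes beta <= 1/4 and beta >= 1/4, and n^(-beta) also absorbs 1/n <= zeta^2
    because beta < 1/2. Since the second moment of the noise part grows with v, a deviation of fixed
    order zeta^2 would not do under the alternative. There the deviation is v / 2, and the ratio
    (zeta^4 + zeta^2 v) / v^2 is small as soon as v / zeta^2 is large. Independence is given only as
    a product formula for preimages of measurable sets; factorised expectations of functions of
    disjoint groups of noise variables have to be derived from it. *)

Set Implicit Arguments.
Unset Strict Implicit.
Unset Printing Implicit Defensive.

(** * Independence of events generated by disjoint groups of variables *)

Section independence.
Context d (Om : measurableType d) (R : realType) (P : probability Om R).
Local Open Scope ereal_scope.

Definition indep_events (A B : set Om) := P (A `&` B) = P A * P B.

(** Pi-lambda argument: for a fixed [F], the events independent of [F] are stable under complements
    and countable disjoint unions. *)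
Lemma indep_events_generated (G : set_system Om) (F : set Om) :
  setI_closed G -> G `<=` measurable -> measurable F ->
  (forall A, G A -> indep_events A F) ->
  forall A, <<s G >> A -> indep_events A F.
Proof.
move=> GI Gm mF GF.
have sGm : <<s G >> `<=` measurable.
  by apply: smallest_sub => //; exact: sigma_algebra_measurable.
have PFfin : P F \is a fin_num by exact: fin_num_measure.
have setC_F (S : set Om) : measurable S -> indep_events S F -> indep_events (~` S) F.
  move=> mS PS; rewrite /indep_events setIC -setDE measureD//; last first.
    by rewrite ltey_eq PFfin.
  rewrite /= [F `&` S]setIC PS probability_setC//.
  by rewrite muleBl// ?mul1e// fin_num_adde_defl// fin_numN fin_num_measure.
have bigcup_F (S : (set Om)^nat) : (forall n, measurable (S n)) ->
    trivIset setT S -> (forall n, indep_events (S n) F) ->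
    indep_events (\bigcup_k S k) F.
  move=> mS tS PS; rewrite /indep_events setI_bigcupl.
  rewrite !measure_bigcup//=.
  - rewrite [RHS]muleC -(fineK PFfin) -nneseriesZl//.
    by apply: eq_eseriesr => i _; rewrite fineK// muleC; exact: PS.
  - by move=> i _; exact: measurableI.
  - exact: trivIset_setIr.
apply: (@dynkin_induction _ (g_sigma_algebraType G) G) => //.
- by rewrite /indep_events setTI probability_setT mul1e.
- by move=> S mS; apply: setC_F; exact: sGm.
- by move=> S mS; apply: bigcup_F => n; apply: sGm; exact: mS.
Qed.

Context (J : finType) (xi : J -> Om -> R).
Hypothesis mxi : forall i, measurable_fun setT (xi i).
Hypothesis xi_prod : forall B : J -> set R, (forall i, measurable (B i)) ->
  fine (P (\bigcap_(i in [set: J]) (xi i @^-1` B i)))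
  = (\prod_(i : J) fine (P (xi i @^-1` B i)))%R.

(** A pi-system generating the sigma-algebra of the variables indexed by [S]. The family [B] ranges
    over all of [J] and is trivial off [S], so that the product hypothesis, which speaks of full
    families, applies as it stands. *)
Definition cylinder (S : pred J) : set_system Om :=
  [set A | exists B : J -> set R, [/\ forall i, measurable (B i),
    forall i, ~~ S i -> B i = setT &
    A = \bigcap_(i in [set: J]) (xi i @^-1` B i)]].

Lemma cylinder_setI_closed S : setI_closed (cylinder S).
Proof.
move=> _ _ [B1 [m1 n1 ->]] [B2 [m2 n2 ->]].
exists (fun i => B1 i `&` B2 i); split.
- by move=> i; exact: measurableI.
- by move=> i Si; rewrite n1// n2// setIT.
- by rewrite bigcapI.
Qed.

Lemma cylinder_measurable S : cylinder S `<=` measurable.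
Proof.
move=> _ [B [mB _ ->]].
apply: fin_bigcap_measurable => // i _; rewrite -[X in measurable X]setTI.
exact: mxi.
Qed.

Lemma cylinder_indep (S S' : pred J) A B : (forall i, S i -> ~~ S' i) ->
  cylinder S A -> cylinder S' B -> indep_events A B.
Proof.
move=> SS' CA CB; have mA := cylinder_measurable CA.
have mB := cylinder_measurable CB.
case: CA => A' [mA' nA AE]; case: CB => B' [mB' nB BE].
rewrite /indep_events -[LHS]fineK ?fin_num_measure//; last exact: measurableI.
rewrite -[P A]fineK ?fin_num_measure// -[P B]fineK ?fin_num_measure// -EFinM.
congr EFin.
rewrite AE BE -bigcapI.
rewrite (@xi_prod (fun i => A' i `&` B' i)); last first.
  by move=> i; exact: measurableI.
rewrite !xi_prod// -big_split/=; apply: eq_bigr => i _.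
have [Si|Si] := boolP (S i).
  by rewrite nB ?SS'// setIT preimage_setT probability_setT mulr1.
by rewrite nA// setTI preimage_setT probability_setT mul1r.
Qed.

(** Measurability for the sub-sigma-algebra is ordinary measurability from another type, so closure
    under sums, products and powers is inherited. *)
Definition adapted S (X : Om -> R) :=
  measurable_fun setT (X : g_sigma_algebraType (cylinder S) -> R).

Lemma adapted_xi (S : pred J) i : S i -> adapted S (xi i).
Proof.
move=> Si _ B mB; rewrite setTI; apply: sub_sigma_algebra.
exists (fun j => if j == i then B else setT); split.
- by move=> j; case: ifP.
- by move=> j; case: eqP => // ->; rewrite Si.
- rewrite eqEsubset; split => [w Bw j _|w /(_ i I)]; last by rewrite /= eqxx.
  by rewrite /preimage/=; case: eqP => // ->.
Qed.

Lemma adapted_measurable S X : adapted S X -> measurable_fun setT X.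
Proof.
move=> aX _ B mB; have := aX measurableT B mB; rewrite !setTI.
apply: smallest_sub; first exact: sigma_algebra_measurable.
exact: cylinder_measurable.
Qed.

(** The pi-lambda argument is used once per side: first the event of [X] is reduced to a cylinder,
    then the event of [Y], which leaves two cylinders over disjoint index sets. *)
Lemma adapted_indep (S S' : pred J) X Y A B : (forall i, S i -> ~~ S' i) ->
  adapted S X -> adapted S' Y -> measurable A -> measurable B ->
  indep_events (X @^-1` A) (Y @^-1` B).
Proof.
move=> SS' aX aY mA mB.
have sX := aX measurableT A mA; have sY := aY measurableT B mB.
rewrite !setTI in sX sY.
have mY : measurable (Y @^-1` B).
  by rewrite -[X in measurable X]setTI; exact: (adapted_measurable aY).
apply: (@indep_events_generated (cylinder S) _ _ _ _ _ _ sX) => //.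
  exact: cylinder_setI_closed.
  exact: cylinder_measurable.
move=> C CC; rewrite /indep_events setIC muleC -/(indep_events _ C).
apply: (@indep_events_generated (cylinder S') _ _ _ _ _ _ sY) => //.
- exact: cylinder_setI_closed.
- exact: cylinder_measurable.
- exact: (cylinder_measurable CC).
move=> D CD; rewrite /indep_events setIC muleC.
exact: cylinder_indep CC CD.
Qed.
End independence.

(** * Expectation of a product of independent variables *)

Section indep_expectation.
Context d (Om : measurableType d) (R : realType) (P : probability Om R).
Variables X Y : Om -> R.
Hypothesis mX : measurable_fun setT X.
Hypothesis mY : measurable_fun setT Y.
Hypothesis XY : forall A B, measurable A -> measurable B ->
  indep_events P (X @^-1` A) (Y @^-1` B).
Let XYf w := (X w, Y w).
Let mXY : measurable_fun setT XYf. Proof. exact: measurable_fun_pair. Qed.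
HB.instance Definition _ := isMeasurableFun.Build _ _ _ _ X mX.
HB.instance Definition _ := isMeasurableFun.Build _ _ _ _ Y mY.
HB.instance Definition _ := isMeasurableFun.Build _ _ _ _ XYf mXY.
Local Open Scope ereal_scope.

Let PX := distribution P X.
Let PY := distribution P Y.

(** The product measure is determined by its values on rectangles, where the equality is the
    independence hypothesis. *)
Lemma joint_lawE (C : set (R * R)) : measurable C ->
  (PX \x PY) C = P (XYf @^-1` C).
Proof.
move=> mC; apply: (product_measure_unique (m' := distribution P XYf)) => //.

Qed.

Hypothesis iX : P.-integrable setT (EFin \o X).
Hypothesis iY : P.-integrable setT (EFin \o Y).

Let integral_law (Z : {mfun Om >-> R}) : P.-integrable setT (EFin \o Z) ->
  (distribution P Z).-integrable setT EFin /\
  \int[distribution P Z]_x x%:E = \int[P]_w (Z w)%:E.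
Proof.
move=> iZ; split.
  by apply: integrable_pushforward => //; rewrite preimage_setT.
by rewrite integral_pushforward// preimage_setT.
Qed.

Let iPX : PX.-integrable setT EFin. Proof. by have [] := integral_law iX. Qed.
Let iPY : PY.-integrable setT EFin. Proof. by have [] := integral_law iY. Qed.

Let prod_fun : R * R -> \bar R := fun z => (z.1 * z.2)%:E.

Let mprod : measurable_fun setT prod_fun.
Proof. by apply/measurable_EFinP; exact: measurable_funM. Qed.

Let integrable_prod : (PX \x PY).-integrable setT prod_fun.
Proof.
apply/integrable12ltyP => //; rewrite /prod_fun/=.
have mnorm : measurable_fun setT (fun x : R => `|x|%:E).
  by apply/measurable_EFinP; exact: normr_measurable.
under eq_integral => x _.
  under eq_integral do rewrite normrM EFinM.
  rewrite ge0_integralZl//.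
  over.
have fY : \int[PY]_y `|y|%:E \is a fin_num.
  by have /integrableP[_] := iPY; rewrite ge0_fin_numE//; exact: integral_ge0.
rewrite -/PX -/PY -(fineK fY) ge0_integralZr//; last first.
  by rewrite lee_fin fine_ge0// integral_ge0.
rewrite lte_mul_pinfty// ?integral_ge0//; last by rewrite ltry.
by have /integrableP[_] := iPX; rewrite ge0_fin_numE//; exact: integral_ge0.
Qed.

Lemma indep_integrableM : P.-integrable setT (EFin \o (X \* Y)%R).
Proof.
have /integrableP[_] := integrable_prod.
rewrite (eq_measure_integral (distribution P XYf)); last first.
  by move=> C mC _; exact: joint_lawE.
rewrite ge0_integral_pushforward//; last by apply: measurableT_comp.
rewrite preimage_setT => XYoo; apply/integrableP; split => //.
by apply/measurable_EFinP; exact: measurable_funM.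
Qed.

(** Both sides are moved to the laws of the variables; there the claim is Fubini for the product of
    the two laws. *)
Lemma indep_expectationM :
  (\int[P]_w (X w * Y w) = (\int[P]_w X w) * (\int[P]_w Y w))%R.
Proof.
have [_ eX] := integral_law iX; have [_ eY] := integral_law iY.
rewrite /Rintegral -fineM ?integrable_fin_num//.
rewrite -eX -eY; congr fine.
transitivity (\int[distribution P XYf]_z prod_fun z).
  by rewrite integral_pushforward ?preimage_setT//; exact: indep_integrableM.
transitivity (\int[PX \x PY]_z prod_fun z).
  by apply/esym/eq_measure_integral => C mC _; exact: joint_lawE.
rewrite -integral12_prod_meas1// /fubini_F /prod_fun/=.
under eq_integral => x _.
  under eq_integral do rewrite EFinM.
  rewrite integralZl//.
  over.
have fY : \int[PY]_y y%:E \is a fin_num by exact: integrable_fin_num.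
by rewrite -/PX -/PY -(fineK fY) integralZr.
Qed.
End indep_expectation.

(** * Calculus of first and second moments *)

Section second_moments.
Context d (Om : measurableType d) (R : realType) (P : probability Om R).
Implicit Types X Y : Om -> R.

Definition mean X : R := \int[P]_w X w.
Definition L1 X := P.-integrable setT (EFin \o X).
(** Measurability is a separate clause because that of the square does not imply that of [X]. *)
Definition L2 X := measurable_fun setT X /\ L1 (fun w => X w ^+ 2).

Lemma L1_cst (k : R) : L1 (fun=> k).
Proof. exact: finite_measure_integrable_cst. Qed.

Lemma mean_cst (k : R) : mean (fun=> k) = k.
Proof. by rewrite /mean Rintegral_cst//= probability_setT mulr1. Qed.

Lemma L1D X Y : L1 X -> L1 Y -> L1 (fun w => X w + Y w).
Proof. by move=> iX iY; have := integrableD measurableT iX iY. Qed.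

Lemma meanD X Y : L1 X -> L1 Y -> mean (fun w => X w + Y w) = mean X + mean Y.
Proof. by move=> iX iY; exact: RintegralD. Qed.

Lemma L1Z k X : L1 X -> L1 (fun w => k * X w).
Proof. by move=> iX; have := integrableZl measurableT k iX. Qed.

Lemma meanZ k X : L1 X -> mean (fun w => k * X w) = k * mean X.
Proof. by move=> iX; exact: RintegralZl. Qed.

Lemma L1_sum (I : Type) (s : seq I) (F : I -> Om -> R) :
  (forall i, L1 (F i)) -> L1 (fun w => \sum_(i <- s) F i w).
Proof.
move=> iF; elim: s => [|i s ih].
  by under [X in L1 X]eq_fun do rewrite big_nil; exact: L1_cst.
by under [X in L1 X]eq_fun do rewrite big_cons; exact: L1D.
Qed.

Lemma mean_sum (I : Type) (s : seq I) (F : I -> Om -> R) :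
  (forall i, L1 (F i)) ->
  mean (fun w => \sum_(i <- s) F i w) = \sum_(i <- s) mean (F i).
Proof.
move=> iF; elim: s => [|i s ih].
  by rewrite big_nil; under [X in mean X]eq_fun do rewrite big_nil;
    exact: mean_cst.
under [X in mean X]eq_fun do rewrite big_cons.
by rewrite meanD ?big_cons ?ih//; exact: L1_sum.
Qed.

Lemma le_mean X Y : L1 X -> L1 Y -> (forall w, X w <= Y w) -> mean X <= mean Y.
Proof. by move=> iX iY XY; exact: le_Rintegral. Qed.

Lemma le_L1 X Y : measurable_fun setT X -> (forall w, `|X w| <= Y w) ->
  L1 Y -> L1 X.
Proof.
move=> mX XY; apply: le_integrable => //; first exact/measurable_EFinP.
by move=> w _; rewrite /= lee_fin (le_trans (XY w))// ler_norm.
Qed.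

Lemma normM_le_sqrD (x y : R) : `|x * y| <= 2^-1 * (x ^+ 2 + y ^+ 2).
Proof.
have := sqr_ge0 (x + y); have := sqr_ge0 (x - y).
by rewrite ler_norml; move=> h1 h2; apply/andP; split; nra.
Qed.

Lemma L2M X Y : L2 X -> L2 Y -> L1 (fun w => X w * Y w).
Proof.
move=> [mX iX] [mY iY]; apply: (@le_L1 _ (fun w => 2^-1 * (X w ^+ 2 + Y w ^+ 2))).
- exact: measurable_funM.
- by move=> w; exact: normM_le_sqrD.
- exact/L1Z/L1D.
Qed.

(** This arithmetic form replaces Cauchy-Schwarz. Nothing is lost below, where both second moments
    have the same bound. *)
Lemma norm_meanM X Y : L2 X -> L2 Y ->
  `|mean (fun w => X w * Y w)|
    <= (mean (fun w => X w ^+ 2) + mean (fun w => Y w ^+ 2)) / 2.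
Proof.
move=> LX LY; have iXY := L2M LX LY; have [_ iX] := LX; have [_ iY] := LY.
rewrite [leRHS]mulrC -meanD// -meanZ; last exact: L1D.
have iS : L1 (fun w => 2^-1 * (X w ^+ 2 + Y w ^+ 2)) by exact/L1Z/L1D.
rewrite ler_norml; apply/andP; split; last first.
  by apply: le_mean => // w; have /ler_normlP[] := normM_le_sqrD (X w) (Y w).
rewrite lerNl -mulN1r -meanZ//.
apply: le_mean => //; first exact: L1Z.
by move=> w; rewrite mulN1r; have /ler_normlP[] := normM_le_sqrD (X w) (Y w).
Qed.

Lemma L2_L1 X : L2 X -> L1 X.
Proof.
move=> [mX iX]; apply: (@le_L1 _ (fun w => 2^-1 * (X w ^+ 2 + 1))) => //.
  by move=> w; have := normM_le_sqrD (X w) 1; rewrite mulr1 expr1n.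
by apply/L1Z/L1D => //; exact: L1_cst.
Qed.

Lemma L2D X Y : L2 X -> L2 Y -> L2 (fun w => X w + Y w).
Proof.
move=> [mX iX] [mY iY]; split; first exact: measurable_funD.
apply: (@le_L1 _ (fun w => 2 * (X w ^+ 2 + Y w ^+ 2))).
- by apply: measurable_funX; exact: measurable_funD.
- move=> w; rewrite ger0_norm ?sqr_ge0//.
  by have := sqr_ge0 (X w - Y w); nra.
- exact/L1Z/L1D.
Qed.

Lemma L2Z k X : L2 X -> L2 (fun w => k * X w).
Proof.
move=> [mX iX]; split; first exact: measurable_funM.
by under [Z in L1 Z]eq_fun do rewrite exprMn; exact: L1Z.
Qed.

Lemma L2_sum (I : Type) (s : seq I) (F : I -> Om -> R) :
  (forall i, L2 (F i)) -> L2 (fun w => \sum_(i <- s) F i w).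
Proof.
move=> iF; elim: s => [|i s ih].
  under [Z in L2 Z]eq_fun do rewrite big_nil; split => //; exact: L1_cst.
by under [Z in L2 Z]eq_fun do rewrite big_cons; exact: L2D.
Qed.

(* Only pairs related by [c] both ways contribute to the expanded square; there
   are at most [D] of them per index, and each is bounded by AM-GM. *)
Lemma second_moment_sum_le (T : finType) (Q : T -> Om -> R) (c : rel T)
    (B D : R) (a : T -> R) :
  0 <= B ->
  (forall p, L2 (Q p)) -> (forall p, mean (fun w => Q p w ^+ 2) <= B) ->
  (forall p q, ~~ c p q -> mean (fun w => Q p w * Q q w) = 0) ->
  (forall p, #|c p|%:R <= D) ->
  mean (fun w => (\sum_p a p * Q p w) ^+ 2) <= B * D * \sum_p a p ^+ 2.
Proof.
move=> B0 LQ QB c0 cD.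
have -> : (fun w => (\sum_p a p * Q p w) ^+ 2) =
    (fun w => \sum_p \sum_q (a p * a q) * (Q p w * Q q w)).
  apply/funext => w; rewrite expr2 mulr_suml; apply: eq_bigr => p _.
  by rewrite mulr_sumr; apply: eq_bigr => q _; rewrite mulrACA.
have iQQ p q : L1 (fun w => (a p * a q) * (Q p w * Q q w)).
  by apply: L1Z; exact: L2M.
rewrite mean_sum => [|p]; last exact: L1_sum.
under eq_bigr do rewrite mean_sum//.
(* The AM-GM bound is split into a part carrying [a p] and a part carrying [a q]; after exchanging
   the sums in the second, both are controlled by the row counts of [c]. *)
pose u p q := (c p q)%:R * (a p ^+ 2 * (B / 2)).
apply: (@le_trans _ _ (\sum_p \sum_q (u p q + u q p))).
  apply: ler_sum => p _; apply: ler_sum => q _.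
  rewrite meanZ; last exact: L2M.
  have u0 p' q' : 0 <= u p' q'.
    by rewrite mulr_ge0// mulr_ge0 ?sqr_ge0// divr_ge0.
  have [cpq|cpq] := boolP (c p q); last by rewrite c0// mulr0 addr_ge0.
  have [cqp|cqp] := boolP (c q p); last first.
    have := c0 _ _ cqp; under [Z in mean Z]eq_fun do rewrite mulrC.
    by move=> ->; rewrite mulr0 addr_ge0.
  rewrite /u cpq cqp !mul1r.
  have mB : `|mean (fun w => Q p w * Q q w)| <= B.
    apply: (le_trans (norm_meanM (LQ p) (LQ q))).
    by rewrite ler_pdivrMr// mulr_natr mulr2n lerD.
  apply: (le_trans (ler_norm _)); rewrite normrM.
  apply: (@le_trans _ _ (`|a p * a q| * B)); first by rewrite ler_wpM2l.
  rewrite -mulrDl mulrA [leRHS]mulrAC ler_wpM2r//.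
  rewrite normrM -(real_normK (num_real (a p))) -(real_normK (num_real (a q))).
  have := sqr_ge0 (`|a p| - `|a q|); nra.
have su : \sum_p \sum_q u p q <= B / 2 * D * \sum_p a p ^+ 2.
  rewrite mulr_sumr; apply: ler_sum => p _.
  have -> : \sum_q u p q = #|c p|%:R * (a p ^+ 2 * (B / 2)).
    rewrite -mulr_suml -sum1_card natr_sum [in RHS]big_mkcond; congr (_ * _).
    by apply: eq_bigr => q _; rewrite unfold_in; case: (c p q).
  rewrite [leRHS]mulrAC [leRHS]mulrC [B / 2 * _]mulrC ler_wpM2r//.
  by rewrite mulr_ge0 ?sqr_ge0// divr_ge0.
under eq_bigr do rewrite big_split.
rewrite big_split/= [X in _ + X]exchange_big/=.
apply: (le_trans (lerD su su)); lra.
Qed.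
End second_moments.

(** The increment R_i involves the noise at i and i+1, so [far] indices are exactly those whose
    increments share no noise variable. *)
Definition far (i j : nat) : bool := (i.+2 <= j)%N || (j.+2 <= i)%N.

Lemma farC i j : far i j = far j i. Proof. by rewrite /far orbC. Qed.

Lemma far_dist i j : far i j = (2 <= i - j + (j - i))%N.
Proof. by rewrite /far; apply/idP/idP; lia. Qed.

Lemma norm_natrB (R : numDomainType) (i j : nat) :
  `|i%:R - j%:R : R| = (i - j + (j - i))%:R.
Proof.
have [ij|/ltnW ji] := leqP i j.
  rewrite (eqP (_ : i - j == 0)%N) ?subn_eq0//.
  by rewrite distrC ger0_norm ?subr_ge0 ?ler_nat// natrB.
rewrite (eqP (_ : j - i == 0)%N) ?subn_eq0// addn0.
by rewrite ger0_norm ?subr_ge0 ?ler_nat// natrB.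
Qed.

Lemma card_near n (i : nat) : (#|[pred k : 'I_n | ~~ far k i]| <= 3)%N.
Proof.
rewrite cardE -(size_map val); apply: (@uniq_leq_size _ _ [:: i.-1; i; i.+1]).
  by rewrite map_inj_uniq ?enum_uniq//; exact: val_inj.
(* At [i = 0] the candidate [i.-1] repeats [i]; the list only has to contain all near indices. *)
move=> k /mapP[l]; rewrite mem_enum inE => il ->.
by move: il; rewrite /far !inE /=; lia.
Qed.

(** * Moments of the centred squared increments and of their quadratic forms *)

Section noise_moments.
Context d (Om : measurableType d) (R : realType) (P : probability Om R).
Context (Cxi : R) (n : nat) (xi : 'I_n.+1 -> Om -> R).
Hypothesis iid : iid_noise Cxi P xi.

Lemma noise_measurable i : measurable_fun setT (xi i).
Proof. by have [+ _] := iid; apply. Qed.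

(** The transfer for nonnegative [g] presupposes no integrability, so it can serve to prove the
    integrability that the signed case [noise_mean] relies on. *)
Lemma noise_ge0_integral (g : R -> \bar R) i : measurable_fun setT g ->
  (forall x, (0 <= g x)%E) ->
  (\int[P]_w g (xi i w) = \int[P]_w g (xi ord0 w))%E.
Proof.
have [mxi [_ [idd _]]] := iid => mg g0.
rewrite -[X in integral P X _](preimage_setT (xi i)).
rewrite -(ge0_integral_pushforward (mxi i))//.
rewrite -[X in integral P X _](preimage_setT (xi ord0)).
rewrite -(ge0_integral_pushforward (mxi ord0))//.
by apply: eq_measure_integral => A mA _; exact: idd.
Qed.

Lemma noise_sqr_L2 i : L2 P (fun w => xi i w ^+ 2).
Proof.
have [_ [_ [_ [m4 _]]]] := iid.
split; first exact/measurable_funX/noise_measurable.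
apply/integrableP; split.
  by apply/measurable_EFinP; do 2 apply: measurable_funX; exact: noise_measurable.
apply: (@le_lt_trans _ _ (\int[P]_w (xi i w ^+ 4)%:E)%E).
  rewrite le_eqVlt; apply/orP; left; apply/eqP.
  apply: eq_integral => w _ /=.
  by rewrite -exprM ger0_norm// -[(2 * 2)%N]/(2 * 2)%N exprM sqr_ge0.
rewrite (@noise_ge0_integral (fun x => (x ^+ 4)%:E)).
- exact: le_lt_trans m4 (ltry _).
- by apply/measurable_EFinP; exact: measurable_funX.
- by move=> x; rewrite lee_fin -[4%N]/(2 * 2)%N exprM sqr_ge0.
Qed.

Lemma noise_L2 i : L2 P (xi i).
Proof. by split; [exact: noise_measurable|exact/L2_L1/noise_sqr_L2]. Qed.

Lemma noise_mean4 i : mean P (fun w => xi i w ^+ 4) <= Cxi.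
Proof.
have [_ [_ [_ [m4 _]]]] := iid.
have := m4; rewrite /mean /Rintegral.
rewrite -(@noise_ge0_integral (fun x => (x ^+ 4)%:E) i).
- move=> h; rewrite -[leRHS]/(fine Cxi%:E) fine_le//.
  rewrite ge0_fin_numE; first exact: le_lt_trans h (ltry _).
  by apply: integral_ge0 => w _; rewrite lee_fin -[4%N]/(2 * 2)%N exprM sqr_ge0.
- by apply/measurable_EFinP; exact: measurable_funX.
- by move=> x; rewrite lee_fin -[4%N]/(2 * 2)%N exprM sqr_ge0.
Qed.

Lemma noise_mean2 i : mean P (fun w => xi i w ^+ 2) = 1.
Proof.
have [_ [_ [_ [_ [_ m2]]]]] := iid.
rewrite /mean /Rintegral (@noise_ge0_integral (fun x => (x ^+ 2)%:E)) ?m2//.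
- by apply/measurable_EFinP; exact: measurable_funX.
- by move=> x; rewrite lee_fin sqr_ge0.
Qed.

Lemma noise_mean i : mean P (xi i) = 0.
Proof.
have [mxi [_ [idd [_ [m1 _]]]]] := iid.
have iE j : P.-integrable (xi j @^-1` setT) (EFin \o xi j).
  by rewrite preimage_setT; exact/L2_L1/noise_L2.
have E j : (\int[pushforward P (xi j)]_x x%:E = \int[P]_w (xi j w)%:E)%E.
  by rewrite (integral_pushforward (mxi j) _ (iE j))// preimage_setT.
rewrite /mean /Rintegral -E (eq_measure_integral (pushforward P (xi ord0))).
  by rewrite E m1.
by move=> A mA _; exact: idd.
Qed.

Lemma indep_meanM (S S' : pred 'I_n.+1) X Y : (forall i, S i -> ~~ S' i) ->
  adapted xi S X -> adapted xi S' Y -> L1 P X -> L1 P Y ->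
  L1 P (fun w => X w * Y w) /\
  mean P (fun w => X w * Y w) = mean P X * mean P Y.
Proof.
have [mxi [pxi _]] := iid => SS' aX aY iX iY.
have mX := adapted_measurable mxi aX; have mY := adapted_measurable mxi aY.
have XY A B : measurable A -> measurable B ->
    indep_events P (X @^-1` A) (Y @^-1` B).
  by move=> mA mB; exact: (adapted_indep mxi pxi SS' aX aY).
split; first exact: (indep_integrableM mX mY XY iX iY).
exact: (indep_expectationM mX mY XY iX iY).
Qed.

Variables (A : R) (delta s : nat -> R).
Hypothesis delta_le : forall i, (i < n)%N -> delta i ^+ 2 <= A.
Hypothesis s_le : forall i, (i <= n)%N -> s i ^+ 2 <= A.

Let X i w := s i * xi (inord i) w.
(** This is R_i, with [delta i] standing for f(x_(i+1)) - f(x_i) and [s i] for the square root of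
    V(x_i). Since [inord] is faithful only up to [n], the facts below that tell noise indices apart
    assume [i < n]. *)
Definition increment i w := delta i + s i.+1 * xi (inord i.+1) w
  - s i * xi (inord i) w.
Definition incr_mean i := delta i ^+ 2 + s i ^+ 2 + s i.+1 ^+ 2.
Definition centered_sqr i w := increment i w ^+ 2 - incr_mean i.

Let A0 : (0 < n)%N -> 0 <= A.
Proof. by move=> n0; exact: le_trans (sqr_ge0 _) (s_le (leq0n _)). Qed.

Lemma adapted_increment (S : pred 'I_n.+1) i :
  S (inord i) -> S (inord i.+1) -> adapted xi S (increment i).
Proof.
move=> Si Si1; apply: measurable_funB; last first.
  by apply: measurable_funM => //; exact: (adapted_xi Si).
apply: measurable_funD => //.
by apply: measurable_funM => //; exact: (adapted_xi Si1).
Qed.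

Lemma adapted_centered_sqr (S : pred 'I_n.+1) i :
  S (inord i) -> S (inord i.+1) -> adapted xi S (centered_sqr i).
Proof.
move=> Si Si1; apply: measurable_funB => //.
by apply: measurable_funX; exact: adapted_increment.
Qed.

Let L2X i : L2 P (X i). Proof. by apply: L2Z; exact: noise_L2. Qed.

Lemma increment_L2 i : L2 P (increment i).
Proof.
have -> : increment i = (fun w => delta i + (X i.+1 w + (-1) * X i w)).
  by apply/funext => w; rewrite /increment /X; ring.
by apply: L2D; [split => //; exact: L1_cst|apply: L2D => //; exact: L2Z].
Qed.

Lemma inord_neqS i : (i < n)%N -> inord i != inord i.+1 :> 'I_n.+1.
Proof. by move=> i_n; rewrite -val_eqE/= !inordK//; lia. Qed.

Lemma mean_increment_sqr i : (i < n)%N ->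
  mean P (fun w => increment i w ^+ 2) = incr_mean i.
Proof.
move=> i_n; set j := inord i.+1 : 'I_n.+1; set k := inord i : 'I_n.+1.
have kj : k != j by exact: inord_neqS.
have disj (m : 'I_n.+1) : pred1 j m -> ~~ pred1 k m.
  by move=> /eqP ->; rewrite /= eq_sym.
have aj : adapted xi (pred1 j) (xi j) by apply: adapted_xi; exact: eqxx.
have ak : adapted xi (pred1 k) (xi k) by apply: adapted_xi; exact: eqxx.
have [ijk] := indep_meanM disj aj ak (L2_L1 (noise_L2 j)) (L2_L1 (noise_L2 k)).
rewrite !noise_mean mulr0 => ejk.
have ij2 := L2_L1 (noise_sqr_L2 j); have ik2 := L2_L1 (noise_sqr_L2 k).
have ij := L2_L1 (noise_L2 j); have ik := L2_L1 (noise_L2 k).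
have -> : (fun w => increment i w ^+ 2) = (fun w => delta i ^+ 2 +
    (s i.+1 ^+ 2 * xi j w ^+ 2 + (s i ^+ 2 * xi k w ^+ 2 +
    (2 * delta i * s i.+1 * xi j w + (- 2 * delta i * s i * xi k w +
     (- 2 * s i * s i.+1) * (xi j w * xi k w)))))).
  by apply/funext => w; rewrite /increment -/j -/k; ring.
have ic := L1_cst P (delta i ^+ 2).
have L1Z' := L1Z; have L1D' := L1D.
do ![rewrite meanD; [|by auto 20..]].
rewrite mean_cst !meanZ// ejk !noise_mean !noise_mean2 /incr_mean; ring.
Qed.

Lemma sqr_sum3_le (a b c : R) :
  (a + b - c) ^+ 2 <= 3 * (a ^+ 2 + b ^+ 2 + c ^+ 2).
Proof.
have := sqr_ge0 (a - b); have := sqr_ge0 (a + c); have := sqr_ge0 (b + c); nra.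
Qed.

(** The constant is 9 * 3: the three-term inequality gives R_i^2 <= 3 A (1 + x^2 + y^2), and after
    squaring it is applied again to 1 + x^2 + y^2. *)
Lemma increment_pow4_le i w : (i < n)%N -> (increment i w ^+ 2) ^+ 2 <=
  27 * A ^+ 2 * (1 + (xi (inord i.+1) w ^+ 4 + xi (inord i) w ^+ 4)).
Proof.
move=> i_n; have A_ge0 : 0 <= A by apply: A0; lia.
have pow4E (x : R) : x ^+ 4 = (x ^+ 2) ^+ 2 by rewrite -exprM.
rewrite !pow4E; set x := xi _ w; set y := xi _ w.
have le1 : increment i w ^+ 2 <= 3 * A * (1 + x ^+ 2 + y ^+ 2).
  apply: (le_trans (sqr_sum3_le _ _ _)); rewrite -mulrA ler_pM2l// !exprMn.
  rewrite !mulrDr mulr1 !lerD ?delta_le//.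
    by rewrite ler_wpM2r ?sqr_ge0// s_le.
  by rewrite ler_wpM2r ?sqr_ge0// s_le// ltnW.
have x0 := sqr_ge0 x; have y0 := sqr_ge0 y.
apply: (@le_trans _ _ ((3 * A * (1 + x ^+ 2 + y ^+ 2)) ^+ 2)).
  by rewrite lerXn2r// nnegrE ?sqr_ge0// !mulr_ge0// !addr_ge0.
rewrite exprMn [X in X * _ <= _](_ : _ = 9 * A ^+ 2); last by ring.
rewrite -[27]/(9 * 3)%:R natrM -!mulrA ler_pM2l// [leRHS]mulrCA.
rewrite ler_wpM2l ?sqr_ge0//.
move: (x ^+ 2) (y ^+ 2) => u v.
have := sqr_ge0 (1 - u); have := sqr_ge0 (1 - v); have := sqr_ge0 (u - v).
nra.
Qed.

Let L1_pow4 i : L1 P (fun w => 27 * A ^+ 2 *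
  (1 + (xi (inord i.+1) w ^+ 4 + xi (inord i) w ^+ 4))).
Proof.
have i4 j : L1 P (fun w => xi j w ^+ 4).
  have [_] := noise_sqr_L2 j.
  by under [X in L1 _ X -> _]eq_fun do rewrite -exprM.
by apply: L1Z; apply: L1D; [exact: L1_cst|exact: L1D].
Qed.

Lemma increment_sqr_L2 i : (i < n)%N -> L2 P (fun w => increment i w ^+ 2).
Proof.
move=> i_n; have [mI _] := increment_L2 i.
split; first exact: measurable_funX.
apply: (le_L1 _ _ (L1_pow4 i)); first by do 2 apply: measurable_funX.
by move=> w; rewrite ger0_norm ?sqr_ge0// increment_pow4_le.
Qed.

Lemma centered_sqr_L2 i : (i < n)%N -> L2 P (centered_sqr i).
Proof.
move=> i_n; apply: L2D; first exact: increment_sqr_L2.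
by split => //; exact: L1_cst.
Qed.

Lemma mean_centered_sqr i : (i < n)%N -> mean P (centered_sqr i) = 0.
Proof.
move=> i_n; rewrite meanD; last exact: L1_cst.
  by rewrite mean_cst mean_increment_sqr// subrr.
exact/L2_L1/increment_sqr_L2.
Qed.

Definition centered_sqr_bound := 27 * A ^+ 2 * (1 + 2 * Cxi).

(** A variance is at most the raw second moment, here that of R_i^2. *)
Lemma mean_sqr_centered_sqr_le i : (i < n)%N ->
  mean P (fun w => centered_sqr i w ^+ 2) <= centered_sqr_bound.
Proof.
move=> i_n; set m := incr_mean i.
have [_ i4] := increment_sqr_L2 i_n; have i2 := L2_L1 (increment_sqr_L2 i_n).
have -> : (fun w => centered_sqr i w ^+ 2) = (fun w => (increment i w ^+ 2) ^+ 2 +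
    ((- 2 * m) * increment i w ^+ 2 + m ^+ 2)).
  by apply/funext => w; rewrite /centered_sqr -/m; ring.
have im := L1_cst P (m ^+ 2).
rewrite meanD//; last by apply: L1D => //; exact: L1Z.
rewrite meanD//; last exact: L1Z.
rewrite meanZ// mean_cst mean_increment_sqr// -/m.
apply: (@le_trans _ _ (mean P (fun w => (increment i w ^+ 2) ^+ 2))).
  by rewrite gerDl; have := sqr_ge0 m; nra.
apply: le_trans (le_mean i4 (L1_pow4 i) (fun w => increment_pow4_le w i_n)) _.
have i4' j : L1 P (fun w => xi j w ^+ 4).
  have [_] := noise_sqr_L2 j.
  by under [X in L1 _ X -> _]eq_fun do rewrite -exprM.
rewrite meanZ; last by apply: L1D; [exact: L1_cst|exact: L1D].
rewrite meanD ?mean_cst; [|exact: L1_cst|exact: L1D].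
rewrite meanD// ler_wpM2l//; first by rewrite mulr_ge0// sqr_ge0.
by rewrite lerD2l mulr_natl mulr2n lerD// noise_mean4.
Qed.

Let block (i : nat) : pred 'I_n.+1 := fun m => (m == inord i) || (m == inord i.+1).

Let far_block i k : (i < n)%N -> (k < n)%N -> far i k ->
  ~~ block k (inord i) /\ ~~ block k (inord i.+1).
Proof.
move=> i_n k_n; rewrite /far /block -!val_eqE/= !inordK; [|lia..].
by move=> ik; split; lia.
Qed.

Let adapted_block i : adapted xi (block i) (centered_sqr i).
Proof. by apply: adapted_centered_sqr; rewrite /block eqxx ?orbT. Qed.

(** Every independence claim below separates one factor Z_k from factors far from k, so a block and
    its complement are the only index sets that occur. *)
Let adapted_coblock i k : (i < n)%N -> (k < n)%N -> far i k ->
  adapted xi (predC (block k)) (centered_sqr i).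
Proof. by move=> i_n k_n ik; have [] := far_block i_n k_n ik; exact: adapted_centered_sqr. Qed.

Let block_disj k m : block k m -> ~~ predC (block k) m.
Proof. by move=> /= ->. Qed.

Lemma mean_centered_sqrM i j : (i < n)%N -> (j < n)%N -> far i j ->
  mean P (fun w => centered_sqr i w * centered_sqr j w) = 0.
Proof.
move=> i_n j_n ij.
have [_ e] := indep_meanM (@block_disj j) (@adapted_block j)
  (adapted_coblock i_n j_n ij) (L2_L1 (centered_sqr_L2 j_n)) (L2_L1 (centered_sqr_L2 i_n)).
by under [X in mean _ X]eq_fun do rewrite mulrC; rewrite e mean_centered_sqr// mul0r.
Qed.

Lemma centered_sqr_bound_ge0 : (0 < n)%N -> 0 <= centered_sqr_bound.
Proof.
move=> n0; apply: le_trans (mean_sqr_centered_sqr_le n0).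
by apply: Rintegral_ge0 => w _; exact: sqr_ge0.
Qed.

Lemma centered_sqrM_L2 i j : (i < n)%N -> (j < n)%N -> far i j ->
  L2 P (fun w => centered_sqr i w * centered_sqr j w) /\
  mean P (fun w => (centered_sqr i w * centered_sqr j w) ^+ 2) <= centered_sqr_bound ^+ 2.
Proof.
move=> i_n j_n ij; have [mi i2] := centered_sqr_L2 i_n; have [mj j2] := centered_sqr_L2 j_n.
have ai : adapted xi (predC (block j)) (fun w => centered_sqr i w ^+ 2).
  by apply: measurable_funX; exact: adapted_coblock.
have aj : adapted xi (block j) (fun w => centered_sqr j w ^+ 2).
  by apply: measurable_funX; exact: adapted_block.
have [l1 e] := indep_meanM (@block_disj j) aj ai j2 i2.
have sqrE : (fun w => (centered_sqr i w * centered_sqr j w) ^+ 2) =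
    (fun w => centered_sqr j w ^+ 2 * centered_sqr i w ^+ 2).
  by apply/funext => w; rewrite exprMn mulrC.
rewrite sqrE e; split.
  by split; [exact: measurable_funM|rewrite sqrE].
have mean_ge0 k : 0 <= mean P (fun w => centered_sqr k w ^+ 2).
  by apply: Rintegral_ge0 => w _; exact: sqr_ge0.
by rewrite expr2 ler_pM// mean_sqr_centered_sqr_le.
Qed.

(** The index k is isolated, so Z_k is independent of the other three factors and its zero mean
    annihilates the product. Integrability of those three comes from [far i j]: both Z_i Z_j and Z_l
    are square integrable. *)
Lemma mean_centered_sqrM4 i j k l : (i < n)%N -> (j < n)%N -> (k < n)%N -> (l < n)%N ->
  far i j -> far k i -> far k j -> far k l ->
  mean P (fun w => (centered_sqr i w * centered_sqr j w) * (centered_sqr k w * centered_sqr l w)) = 0.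
Proof.
move=> i_n j_n k_n l_n ij ki kj kl.
have -> : (fun w => (centered_sqr i w * centered_sqr j w) * (centered_sqr k w * centered_sqr l w)) =
    (fun w => centered_sqr k w * (centered_sqr i w * centered_sqr j w * centered_sqr l w)).
  by apply/funext => w; ring.
have a3 : adapted xi (predC (block k)) (fun w => centered_sqr i w * centered_sqr j w * centered_sqr l w).
  by apply: measurable_funM; [apply: measurable_funM|];
    apply: adapted_coblock => //; rewrite farC.
have [L2ij _] := centered_sqrM_L2 i_n j_n ij.
have [_ ->] := indep_meanM (@block_disj k) (@adapted_block k) a3
  (L2_L1 (centered_sqr_L2 k_n)) (L2M L2ij (centered_sqr_L2 l_n)).
by rewrite mean_centered_sqr// mul0r.
Qed.

(** The indicator makes the product square integrable for every pair, near pairs included, as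
    [second_moment_sum_le] asks of the whole family. *)
Let quad (p : 'I_n * 'I_n) w := (far p.1 p.2)%:R * (centered_sqr p.1 w * centered_sqr p.2 w).
(** Its failure says that one entry of [q] is far from both entries of [p], which is the isolated
    index of [mean_centered_sqrM4]. *)
Let near_pair (p q : 'I_n * 'I_n) :=
  (~~ far q.1 p.1 || ~~ far q.1 p.2) && (~~ far q.2 p.1 || ~~ far q.2 p.2).

(** Each entry of [q] lies in a union of two neighbourhoods of at most 3 indices, hence 6 * 6. *)
Let card_near_pair p : (#|near_pair p| <= 36)%N.
Proof.
pose N (i : nat) := [pred k : 'I_n | ~~ far k i].
pose A' := [predU (N p.1) & (N p.2)].
have A'6 : (#|A'| <= 6)%N.
  apply: (@leq_trans (#|N p.1| + #|N p.2|)); first by rewrite -cardUI leq_addr.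
  by rewrite (leq_add (card_near _ _) (card_near _ _)).
have -> : #|near_pair p| = #|predX A' A'|.
  by apply: eq_card => -[a b]; rewrite !inE.
by rewrite cardX -[36%N]/(6 * 6)%N leq_mul.
Qed.

Let quad_L2 p : L2 P (quad p).
Proof.
rewrite /quad; have [pf|pf] := boolP (far p.1 p.2).
  by apply: L2Z; apply: (centered_sqrM_L2 _ _ pf).1.
under [X in L2 _ X]eq_fun do rewrite mul0r.
by split => //; under [X in L1 _ X]eq_fun do rewrite expr0n; exact: L1_cst.
Qed.

Let quad_ortho p q : ~~ near_pair p q -> mean P (fun w => quad p w * quad q w) = 0.
Proof.
move=> pq; rewrite /quad.
have [pf|pf] := boolP (far p.1 p.2); last first.
  by under [X in mean _ X]eq_fun do rewrite mul0r mul0r; exact: mean_cst.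
have [qf|qf] := boolP (far q.1 q.2); last first.
  by under [X in mean _ X]eq_fun do rewrite mul0r mulr0; exact: mean_cst.
under [X in mean _ X]eq_fun do rewrite !mul1r.
move: pq => /nandP[]/norP[/negPn q1 /negPn q2].
  exact: mean_centered_sqrM4.
under [X in mean _ X]eq_fun do rewrite [centered_sqr q.1 _ * _]mulrC.
by apply: mean_centered_sqrM4 => //; rewrite farC.
Qed.

Lemma quadratic_form_second_moment (a : 'I_n * 'I_n -> R) (g : 'I_n -> R) :
  (0 < n)%N -> (forall p : 'I_n * 'I_n, ~~ far p.1 p.2 -> a p = 0) ->
  L2 P (fun w => \sum_(p : 'I_n * 'I_n) a p * (centered_sqr p.1 w * centered_sqr p.2 w)
     + \sum_(i < n) g i * centered_sqr i w) /\
  mean P (fun w => (\sum_(p : 'I_n * 'I_n) a p * (centered_sqr p.1 w * centered_sqr p.2 w)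
     + \sum_(i < n) g i * centered_sqr i w) ^+ 2) <=
  72 * centered_sqr_bound ^+ 2 * (\sum_p a p ^+ 2)
     + 6 * centered_sqr_bound * (\sum_(i < n) g i ^+ 2).
Proof.
move=> n0 a0.
pose Q w := \sum_(p : 'I_n * 'I_n) a p * (centered_sqr p.1 w * centered_sqr p.2 w).
pose L w := \sum_(i < n) g i * centered_sqr i w.
have QE : Q = fun w => \sum_p a p * quad p w.
  apply/funext => w; apply: eq_bigr => p _; rewrite /quad.
  by have [|/a0 ->] := boolP (far p.1 p.2); rewrite ?mul1r// !mul0r.
have LQ : L2 P Q by rewrite QE; apply: L2_sum => p; exact: L2Z.
have LL : L2 P L by apply: L2_sum => i; apply: L2Z; exact: centered_sqr_L2.
split; first exact: L2D.
have mQ : mean P (fun w => Q w ^+ 2) <= centered_sqr_bound ^+ 2 * 36 * \sum_p a p ^+ 2.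
  rewrite QE; apply: (second_moment_sum_le (c := near_pair)) => //.
  - exact: sqr_ge0.
  - move=> p; rewrite /quad; have [pf|pf] := boolP (far p.1 p.2).
      under [X in mean _ X]eq_fun do rewrite mul1r.
      exact: (centered_sqrM_L2 _ _ pf).2.
    under [X in mean _ X]eq_fun do rewrite mul0r expr0n.
    by rewrite mean_cst sqr_ge0.
  - by move=> p; rewrite ler_nat.
have mL : mean P (fun w => L w ^+ 2) <= centered_sqr_bound * 3 * \sum_(i < n) g i ^+ 2.
  apply: (second_moment_sum_le (c := fun i j : 'I_n => ~~ far j i)) => //.
  - exact: centered_sqr_bound_ge0.
  - by move=> i; exact: centered_sqr_L2.
  - by move=> i; exact: mean_sqr_centered_sqr_le.
  - by move=> i j /=; rewrite negbK farC; exact: mean_centered_sqrM.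
  - by move=> i; rewrite ler_nat; exact: card_near.
have [_ Q2] := LQ; have [_ L2'] := LL.
have [_ QL2] := L2D LQ LL.
have iQL : L1 P (fun w => Q w ^+ 2 + L w ^+ 2) by exact: L1D.
(* This factor 2 turns the counts 36 and 3 of the two parts into 72 and 6. *)
apply: (@le_trans _ _ (mean P (fun w => 2 * (Q w ^+ 2 + L w ^+ 2)))).
  apply: (le_mean QL2 (L1Z 2 iQL)) => w.
  by have := sqr_ge0 (Q w - L w); nra.
rewrite (meanZ 2 iQL) meanD//; lra.
Qed.

End noise_moments.

(** * Chebyshev inequalities for the two tails *)

Section chebyshev.
Context d (Om : measurableType d) (R : realType) (P : probability Om R).

Lemma prob_le_second_moment (X : Om -> R) (S : set Om) (t : R) :
  L2 P X -> 0 < t -> measurable S -> (forall w, S w -> t <= `|X w|) ->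
  fine (P S) <= mean P (fun w => X w ^+ 2) / t ^+ 2.
Proof.
move=> [mX X2] t0 mS SX; rewrite ler_pdivlMr ?exprn_gt0//.
have indicS : mean P (\1_S) = fine (P S).
  by rewrite /mean /Rintegral integral_indic// setIT.
have iS : L1 P (\1_S).
  apply: (@le_L1 _ _ _ _ _ (fun=> 1)) => //; last exact: L1_cst.
  by move=> w; rewrite indicE; case: (w \in S); rewrite ?normr1 ?normr0.
rewrite -indicS mulrC -meanZ//; apply: le_mean => //; first exact: L1Z.
move=> w; rewrite indicE; have [|wS] := boolP (w \in S); last first.
  by rewrite mulr0 sqr_ge0.
rewrite inE => /SX tX; rewrite mulr1 -[leRHS]real_normK ?num_real//.
by rewrite lerXn2r// nnegrE// ltW.
Qed.

Lemma chebyshev_gt (X : Om -> R) (m c t : R) : L2 P X -> 0 < t -> m + t <= c ->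
  fine (P [set w | c < m + X w]) <= mean P (fun w => X w ^+ 2) / t ^+ 2.
Proof.
move=> LX t0 mtc; have [mX _] := LX; apply: prob_le_second_moment => //.
  rewrite (_ : [set _ | _] = (fun w => m + X w) @^-1` `]c, +oo[%classic).
    by rewrite -[X in measurable X]setTI; apply: measurable_funD.
  by apply/seteqP; split => w /=; rewrite in_itv/= andbT.
by move=> w /= cX; apply: le_trans (ler_norm _); lra.
Qed.

Lemma chebyshev_le (X : Om -> R) (m c t : R) : L2 P X -> 0 < t -> c <= m - t ->
  fine (P [set w | m + X w <= c]) <= mean P (fun w => X w ^+ 2) / t ^+ 2.
Proof.
move=> LX t0 mtc; have [mX _] := LX; apply: prob_le_second_moment => //.
  rewrite (_ : [set _ | _] = (fun w => m + X w) @^-1` `]-oo, c]%classic).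
    by rewrite -[X in measurable X]setTI; apply: measurable_funD.
  by apply/seteqP; split => w /=; rewrite in_itv.
by move=> w /= cX; rewrite -normrN; apply: le_trans (ler_norm _); lra.
Qed.
End chebyshev.

(** * Linear change of variables for Lebesgue measure *)

Section lebesgue_scaling.
Context (R : realType) (c : R).
Hypothesis c0 : c != 0.
Notation mu := (@lebesgue_measure R).
Let mulc (x : measurableTypeR R) : measurableTypeR R := c * x.
Let mmulc : measurable_fun setT mulc.
Proof. exact: measurable_funM. Qed.
Let absc : {nonneg R} := (`|c|)%:nng.

Let image_measure : {measure set (measurableTypeR R) -> \bar R}.
Proof.
by refine (pushforward mu mulc : {measure set _ -> \bar R}); exact: mmulc.
Defined.

(** It suffices to compare half-open intervals. A negative factor turns them into intervals closed
    on the other side, of the same length. Both signs are used: [c = h] rescales the kernel and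
    [c = -1] expresses its symmetry. *)
Lemma lebesgue_measure_scale (A : set (measurableTypeR R)) : measurable A ->
  mu A = mscale absc image_measure A.
Proof.
move=> mA; apply: lebesgue_measure_unique => // _ [[a b] _ <-] /=.
have imE B : image_measure B = mu (mulc @^-1` B) by [].
rewrite /mscale/= imE.
rewrite lebesgue_measure_itv/= lte_fin.
have [cp|cn|ce] := ltgtP 0 c.
- rewrite (_ : _ @^-1` _ = `]a / c, b / c]%classic); last first.
    apply/seteqP; split => x; rewrite /mulc /= !in_itv/=.
      by rewrite ltr_pdivrMr// ler_pdivlMr// mulrC.
    by rewrite ltr_pdivrMr// ler_pdivlMr// mulrC.
  rewrite lebesgue_measure_itv/= lte_fin ltr_pM2r ?invr_gt0//.
  case: ifP => _; last by rewrite mule0.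
  rewrite -!EFinB -EFinM gtr0_norm//; by congr EFin; field.
- rewrite (_ : _ @^-1` _ = `[b / c, a / c[%classic); last first.
    apply/seteqP; split => x; rewrite /mulc /= !in_itv/=.
      by rewrite ler_ndivrMr// ltr_ndivlMr// mulrC andbC.
    by rewrite ler_ndivrMr// ltr_ndivlMr// mulrC andbC.
  rewrite lebesgue_measure_itv/= lte_fin ltr_nM2r ?invr_lt0//.
  case: ifP => _; last by rewrite mule0.
  rewrite -!EFinB -EFinM ltr0_norm//; by congr EFin; field.
- by move: c0; rewrite -ce eqxx.
Qed.

Lemma ge0_integral_scale (D : set R) (f : R -> R) : measurable D ->
  measurable_fun setT f -> (forall x, 0 <= f x) ->
  (\int[mu]_(x in D) (f x)%:E =
   `|c|%:E * \int[mu]_(x in (fun x => c * x)%R @^-1` D) (f (c * x)%R)%:E)%E.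
Proof.
move=> mD mf f0.
rewrite (eq_measure_integral (mscale absc image_measure)); last first.
  by move=> A mA _; exact: lebesgue_measure_scale.
rewrite ge0_integral_mscale//.
  rewrite ge0_integral_pushforward//; last 2 first.
  - apply/measurable_EFinP; exact: measurable_funTS.
  - by move=> x _; rewrite lee_fin.
- apply/measurable_EFinP; exact: measurable_funTS.
- by move=> x _; rewrite lee_fin.
Qed.
End lebesgue_scaling.

(** * Kernel weights and their row sums *)

Section kernel.
Context (R : realType) (kl ku : R) (K : R -> R).
Hypotheses (kl0 : 0 < kl) (klu : kl <= ku) (hK : is_kernel kl ku K).
Notation mu := (@lebesgue_measure R).

Let mK : measurable_fun setT K. Proof. by case: hK. Qed.

Lemma kernel_bounds x : 0 <= K x <= ku.
Proof.
have [_ [K0 [_ [Kb _]]]] := hK; have [x1|x1] := leP `|x| 1.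
  have /Kb/andP[h1 h2] : x \in `[-1, 1] by rewrite in_itv/= -ler_norml.
  by rewrite h2 andbT (le_trans _ h1)// ltW.
by rewrite K0// lexx ltW// (lt_le_trans kl0).
Qed.

Let K_ge0 x : 0 <= K x. Proof. by have /andP[] := kernel_bounds x. Qed.

Definition kernel_mass a b := \int[mu]_(x in `[a, b]) K x.

Lemma kernel_integrable (i : interval R) :
  mu.-integrable [set` i] (EFin \o K).
Proof.
have K1 := (hK.2.2.2.2).
have : mu.-integrable setT (EFin \o K).
  apply/integrableP; split; first exact/measurable_EFinP.
  rewrite (_ : (fun x => _) = (EFin \o K)); last first.
    by apply/funext => x /=; rewrite ger0_norm.
  suff -> : (\int[mu]_x (EFin \o K) x =
             \int[mu]_(x in `[(-1)%R, 1%R]) (K x)%:E)%E by rewrite K1 ltry.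
  rewrite [RHS]integral_mkcond; apply: eq_integral => x _.
  rewrite patchE; case: ifPn => //; rewrite notin_setE/= in_itv/= -ler_norml.
  by move=> /negP; rewrite -ltNge /= => /hK.2.1 ->.
by apply: integrableS => //; exact: measurable_itv.
Qed.

Lemma kernel_mass_ge0 a b : 0 <= kernel_mass a b.
Proof. exact: Rintegral_ge0. Qed.

Lemma kernel_mass_le a b : a <= b -> kernel_mass a b <= ku * (b - a).
Proof.
move=> ab; apply: (@le_trans _ _ (\int[mu]_(x in `[a, b]) ku)); last first.
  rewrite Rintegral_cst//= lebesgue_measure_itv/= lte_fin.
  case: ltgtP ab => //= -> _.
  by rewrite mulr0 subrr mulr0.
apply: le_Rintegral => //; first exact: kernel_integrable.
  apply: measurable_bounded_integrable => //.
    by rewrite /= lebesgue_measure_itv/=; case: ifP => _; rewrite ltry.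
  by exists ku; split; rewrite ?num_real// => x kx y _ /=;
    rewrite ger0_norm ?ltW// (lt_le_trans kl0).
by move=> x _; have /andP[] := kernel_bounds x.
Qed.

Lemma kernel_massD a b c : a <= b -> b <= c ->
  kernel_mass a c = kernel_mass a b + kernel_mass b c.
Proof.
move=> ab bc; rewrite /kernel_mass.
rewrite -(@Rintegral_itv_obnd_cbnd _ b) ?kernel_integrable//.
by rewrite -(@Rintegral_itvB _ K (BLeft a) (BRight c) b (kernel_integrable _))
  ?bnd_simp// addrC subrK.
Qed.

Lemma kernel_mass_out a b : 1 <= a -> kernel_mass a b = 0.
Proof.
(* The kernel need not vanish at 1, so for [a = 1] the left endpoint is removed as a null set. *)
move=> a1; rewrite /kernel_mass -Rintegral_itv_obnd_cbnd ?kernel_integrable//.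
rewrite (@eq_Rintegral _ _ _ _ _ (fun=> 0)).
  by rewrite Rintegral_cst ?mul0r.
move=> x; rewrite inE/= in_itv/= => /andP[ax _].
by rewrite hK.2.1// gtr0_norm ?(le_lt_trans a1)// (lt_le_trans ltr01)//
  (le_trans a1)// ltW.
Qed.

Lemma kernel_mass_sym b : kernel_mass (- b) 0 = kernel_mass 0 b.
Proof.
rewrite /kernel_mass /Rintegral; congr fine.
rewrite (@ge0_integral_scale _ (-1))// ?oppr_eq0 ?oner_eq0//.
rewrite normrN1 mul1e (_ : _ @^-1` _ = `[0, b]%classic).
  by apply: eq_integral => x _; rewrite mulN1r hK.2.2.1.
by apply/seteqP; split => x /=; rewrite !in_itv/= mulN1r lerN2 oppr_le0 andbC.
Qed.

Lemma kernel_mass_half : kernel_mass 0 1 = 1 / 2.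
Proof.
have := hK.2.2.2.2 => /(congr1 fine); rewrite -/(Rintegral _ _ _).
rewrite -/(kernel_mass (-1) 1) (@kernel_massD _ 0)// ?lerN10// kernel_mass_sym/=; lra.
Qed.

Lemma Kint_kernel_mass (h a b : R) : 0 < h -> Kint K h a b = kernel_mass (a / h) (b / h).
Proof.
move=> h0; have hn0 : h != 0 by rewrite gt_eqF.
have mKh : measurable_fun setT (fun x : R => h^-1 * K (x / h)).
  apply: measurable_funM => //; apply: measurableT_comp => //.
  exact: measurable_funM.
have Kh0 x : 0 <= h^-1 * K (x / h) by rewrite mulr_ge0// invr_ge0 ltW.
rewrite /Kint /kernel_mass /Rintegral; congr fine.
rewrite (@ge0_integral_scale _ h)//.
rewrite (_ : _ @^-1` _ = `[a / h, b / h]%classic); last first.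
  by apply/seteqP; split => x /=;
    rewrite !in_itv/= ler_pdivrMr// ler_pdivlMr// mulrC.
rewrite -ge0_integralZl//=; last 2 first.
- apply/measurable_EFinP; apply: measurable_funTS.
  by apply: (measurableT_comp mKh); exact: measurable_funM.
- by move=> x _; rewrite lee_fin.
apply: eq_integral => x _; rewrite -EFinM gtr0_norm// mulrA divff// mul1r.
by rewrite [h * x]mulrC mulfK.
Qed.

Variables (n : nat) (h q : R).
Hypotheses (n0 : (0 < n)%N) (h0 : 0 < h) (qE : q = n%:R * h).
Hypotheses (q2 : 2 <= q) (q8 : 8 * ku <= q).

Let ku0 : 0 < ku. Proof. exact: lt_le_trans klu. Qed.
Let q0 : 0 < q. Proof. exact: lt_le_trans q2. Qed.

Definition lag_weight (t : nat) : R := Knh K n h t%:R.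
Let den := 1 - 2 * kernel_mass 0 (2 / q).

(** With q = n h, the bandwidth in grid steps, lag t receives the kernel mass of the cell from t/q
    to (t+1)/q. The denominator compensates for the mass of the suppressed lags 0 and 1. *)
Lemma lag_weightE t : lag_weight t =
  if (2 <= t)%N then kernel_mass (t%:R / q) (t.+1%:R / q) / den else 0.
Proof.
rewrite /lag_weight /Knh ger0_norm// ler_nat; case: ifP => // _.
rewrite !Kint_kernel_mass//.
have divq (x : R) : x / n%:R / h = x / q by rewrite qE -mulrA -invfM mulrC.
rewrite mulNr !divq natr1 (@kernel_massD (- (2 / q)) 0)//; last 2 first.
- by rewrite oppr_le0 divr_ge0// ltW.
- by rewrite divr_ge0// ltW.
by rewrite kernel_mass_sym /den [2 * kernel_mass _ _]mulr_natl mulr2n.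
Qed.

Let den_half : 1 / 2 <= den.
Proof.
have : kernel_mass 0 (2 / q) <= ku * (2 / q - 0).
  by apply: kernel_mass_le; rewrite divr_ge0// ltW.
rewrite subr0 mulrA => h1.
(* This is where the requirement 8 [ku] <= q comes from: the suppressed mass on both sides is then
   at most 1/2. *)
have : ku * 2 / q <= 1 / 4.
    by rewrite ler_pdivrMr//; move: q8 => q8_; clear h1; lra.
rewrite /den; lra.
Qed.

Let den0 : 0 < den. Proof. by apply: lt_le_trans den_half; lra. Qed.

Lemma lag_weight_ge0 t : 0 <= lag_weight t.
Proof.
rewrite lag_weightE; case: ifP => // _.
by rewrite divr_ge0 ?kernel_mass_ge0// ltW.
Qed.

Lemma lag_weight_le t : lag_weight t <= 2 * ku / q.
Proof.
have kq : 0 <= 2 * ku / q by rewrite divr_ge0 ?mulr_ge0// ltW.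
rewrite lag_weightE; case: ifP => // _; rewrite ler_pdivrMr//.
apply: (@le_trans _ _ (ku * (t.+1%:R / q - t%:R / q))).
  by apply: kernel_mass_le; rewrite ler_pM2r ?invr_gt0// ler_nat.
rewrite -mulrBl -natr1 addrAC subrr add0r mul1r.
have : ku / q * 1 <= ku / q * (2 * den).
  by rewrite ler_pM2l ?divr_gt0//; have := den_half; lra.
by rewrite mulr1 mulrCA !mulrA.
Qed.

Lemma lag_weight_far t : q <= t%:R -> lag_weight t = 0.
Proof.
move=> qt; rewrite lag_weightE; case: ifP => // _.
by rewrite kernel_mass_out ?mul0r// ler_pdivlMr// mul1r.
Qed.

Let half_sumE m : (0 < m)%N -> \sum_(0 <= t < m) lag_weight t.+1 =
  kernel_mass (2 / q) (m.+1%:R / q) / den.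
Proof.
elim: m => // -[_ _|m ih _].
  (* Lag 1 has weight zero, which matches the degenerate interval at 2/q; from there on the cells
     are adjacent and their masses telescope. *)
  rewrite big_nat1 lag_weightE /=.
  suff -> : kernel_mass (2 / q) (2 / q) = 0 by rewrite mul0r.
  have := kernel_mass_ge0 (2 / q) (2 / q).
  have := @kernel_mass_le (2 / q) (2 / q) (lexx _); rewrite subrr mulr0; lra.
rewrite big_nat_recr//= ih// lag_weightE/= -mulrDl; congr (_ / _).
by rewrite -kernel_massD// ler_pM2r ?invr_gt0// ler_nat.
Qed.

(** By symmetry the mass of the kernel between 2/q and 1 is half the denominator, so each side of a
    full window contributes exactly 1/2. *)
Let half_mass b : 2 / q <= b -> kernel_mass (2 / q) b / den <= 1 / 2 /\
  (1 <= b -> kernel_mass (2 / q) b / den = 1 / 2).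
Proof.
move=> bq.
have q1 : 2 / q <= 1 by rewrite ler_pdivrMr// mul1r.
have two0 : 0 <= 2 / q by rewrite divr_ge0// ltW.
have e1 : kernel_mass (2 / q) 1 = 1 / 2 * den.
  have := kernel_massD two0 q1; rewrite kernel_mass_half /den; lra.
have e2 : 1 <= b -> kernel_mass (2 / q) b = 1 / 2 * den.
  by move=> b1; rewrite (kernel_massD q1 b1) (@kernel_mass_out 1)// addr0.
split; last by move=> b1; rewrite e2// mulfK// gt_eqF.
rewrite ler_pdivrMr//; have [b1|b1] := leP 1 b; first by rewrite e2.
by rewrite -e1 (kernel_massD bq (ltW b1)) lerDl kernel_mass_ge0.
Qed.

Lemma half_sum_le m : \sum_(0 <= t < m) lag_weight t.+1 <= 1 / 2.
Proof.
case: m => [|m]; first by rewrite big_geq//; lra.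
rewrite half_sumE//; apply: (half_mass _).1.
by rewrite ler_pM2r ?invr_gt0// ler_nat.
Qed.

Lemma half_sum_eq m : q <= m.+1%:R -> \sum_(0 <= t < m) lag_weight t.+1 = 1 / 2.
Proof.
case: m => [|m] qm; first by have := le_trans q2 qm; rewrite ler_nat.
rewrite half_sumE//; apply: (half_mass _).2.
  by rewrite ler_pM2r ?invr_gt0// ler_nat.
by rewrite ler_pdivlMr// mul1r.
Qed.

Definition pair_weight (i j : nat) := lag_weight (i - j + (j - i)).

Lemma Knh_pair_weight i j : Knh K n h (i%:R - j%:R) = pair_weight i j.
Proof.
by rewrite /pair_weight /lag_weight /Knh norm_natrB [`|_%:R|]ger0_norm.
Qed.

Lemma row_sumE i : (i < n)%N -> \sum_(j < n) pair_weight i j =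
  \sum_(0 <= t < i) lag_weight t.+1 + \sum_(0 <= t < n - i.+1) lag_weight t.+1.
Proof.
move=> i_n; rewrite -(big_mkord xpredT (pair_weight i)).
rewrite (big_cat_nat (leq0n i) (ltnW i_n))/=.
congr (_ + _).
  rewrite big_nat_rev/= add0n; apply: eq_big_nat => t /andP[_ ti].
  by rewrite /pair_weight; congr lag_weight; lia.
rewrite (big_ltn i_n) [X in X + _](_ : _ = 0) ?add0r; last first.
  by rewrite /pair_weight subnn lag_weightE.
rewrite -{1}[i.+1]add0n big_addn; apply: eq_big_nat => t _.
by rewrite /pair_weight; congr lag_weight; lia.
Qed.

Lemma row_sum_le1 i : (i < n)%N -> \sum_(j < n) pair_weight i j <= 1.
Proof.
move=> i_n; rewrite row_sumE//.
by have := half_sum_le i; have := half_sum_le (n - i.+1); lra.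
Qed.

(** One side falls short of 1/2 only when the window of q lags runs past that end of the sample. *)
Lemma row_deficit_le i : (i < n)%N ->
  1 - \sum_(j < n) pair_weight i j <=
  (i.+1%:R < q)%R%:R + ((n - i)%:R < q)%R%:R.
Proof.
move=> i_n; rewrite row_sumE//.
have half (m : nat) : 1 / 2 - \sum_(0 <= t < m) lag_weight t.+1 <=
    (m.+1%:R < q)%R%:R.
  have [mq|mq] := ltP; last by rewrite half_sum_eq// subrr.
  apply: (@le_trans _ _ (1 / 2)); last by rewrite /= mulr1n; lra.
  by rewrite gerBl; apply: sumr_ge0 => t _; exact: lag_weight_ge0.
have := half i; have := half (n - i.+1)%N.
by rewrite (_ : (n - i.+1).+1 = n - i)%N; [lra|lia].
Qed.

(** Induction on the length: when the last index is below q, counting every term still gives at most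
    q. *)
Lemma sum_ltq_le : \sum_(i < n) (i.+1%:R < q)%R%:R <= q.
Proof.
have -> : \sum_(i < n) (i.+1%:R < q)%R%:R = \sum_(1 <= i < n.+1) (i%:R < q)%R%:R :> R.
  by rewrite big_add1/= -(big_mkord xpredT (fun i => (i.+1%:R < q)%R%:R)).
elim: n => [|m ih]; first by rewrite big_geq// ltW.
rewrite big_nat_recr//=; have [mq|_] := ltP m.+1%:R q; last by rewrite addr0.
apply: (@le_trans _ _ (\sum_(1 <= i < m.+1) 1 + 1)).
  by rewrite lerD2r; apply: ler_sum => i _; case: (_ < _).
by rewrite sumr_const_nat subn1/= natr1 ltW.
Qed.

Lemma total_deficit_le :
  \sum_(i < n) (1 - \sum_(j < n) pair_weight i j) <= 2 * q.
Proof.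
apply: (@le_trans _ _ (\sum_(i < n) ((i.+1%:R < q)%R%:R + ((n - i)%:R < q)%R%:R))).
  by apply: ler_sum => i _; exact: row_deficit_le.
rewrite big_split/= [X in _ + X](_ : _ = \sum_(i < n) (i.+1%:R < q)%R%:R).
  by have := sum_ltq_le; lra.
rewrite (reindex_inj rev_ord_inj)/=; apply: eq_bigr => i _.
by rewrite subKn.
Qed.
End kernel.

(** * Deterministic part of the quadratic form and sizes of its coefficients *)

Section bias.
Context (R : realType) (n : nat) (k : 'I_n -> 'I_n -> R) (mu : 'I_n -> R).
Context (B E q kmax : R).
Hypothesis n0 : (0 < n)%N.
Hypothesis k_ge0 : forall i j, 0 <= k i j.
Hypothesis k_sym : forall i j, k i j = k j i.
Hypothesis k_near : forall i j : 'I_n, ~~ far i j -> k i j = 0.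
Hypothesis k_le : forall i j, k i j <= kmax.
Hypothesis row_le1 : forall i, \sum_j k i j <= 1.
Hypothesis deficit_le : \sum_i (1 - \sum_j k i j) <= 2 * q.
Hypothesis E0 : 0 <= E.
Hypothesis mu_ge0 : forall i, 0 <= mu i.
Hypothesis mu_le : forall i, mu i <= B.
Hypothesis mu_lip : forall i j, k i j != 0 -> `|mu i - mu j| <= E.

Let N : R := n%:R.
Let N0 : 0 < N. Proof. by rewrite ltr0n. Qed.
Let NN : N != 0. Proof. by rewrite gt_eqF. Qed.

Definition stat_weight (i j : 'I_n) : R :=
  if far i j then k i j / n%:R - (n%:R ^+ 2)^-1 else 0.

Definition average := n%:R^-1 * \sum_i mu i.
Definition emp_var := n%:R^-1 * \sum_i (mu i - average) ^+ 2.

Let s i := \sum_j k i j.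
Let near_sum (i : 'I_n) := \sum_(j : 'I_n) (~~ far i j)%:R * mu j.

Let sum_cst_n (x : R) : \sum_(i < n) x = N * x.
Proof. by rewrite sumr_const card_ord mulr_natl. Qed.

Lemma emp_varE : emp_var = N^-1 * \sum_i mu i ^+ 2 - average ^+ 2.
Proof.
have sum_mu : \sum_i mu i = N * average by rewrite /average mulVKf.
have -> : emp_var = N^-1 * (\sum_i (mu i ^+ 2 + (- 2 * average) * mu i + average ^+ 2)).
  by rewrite /emp_var; congr (_ * _); apply: eq_bigr => i _; ring.
by rewrite !big_split/= sum_cst_n -mulr_sumr sum_mu; field.
Qed.

Lemma emp_var_ge0 : 0 <= emp_var.
Proof. by rewrite mulr_ge0 ?invr_ge0// sumr_ge0// => i _; exact: sqr_ge0. Qed.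

(** It allows a convenient centre in place of the average, on either side of the testing problem. *)
Lemma emp_var_min c : emp_var <= N^-1 * \sum_i (mu i - c) ^+ 2.
Proof.
have -> : \sum_i (mu i - c) ^+ 2 =
    \sum_i (mu i - average) ^+ 2 + N * (average - c) ^+ 2.
  have S : \sum_i (mu i - average) = 0.
    by rewrite sumrB sum_cst_n /average mulVKf// subrr.
  have -> : \sum_i (mu i - c) ^+ 2 = \sum_i ((mu i - average) ^+ 2 +
      2 * (average - c) * (mu i - average) + (average - c) ^+ 2).
    by apply: eq_bigr => i _; ring.
  by rewrite !big_split/= -mulr_sumr S mulr0 addr0 sum_cst_n.
rewrite mulrDr lerDl mulr_ge0 ?invr_ge0// mulr_ge0 ?sqr_ge0//; exact: ltW.
Qed.

Lemma stat_weight_sym i j : stat_weight i j = stat_weight j i.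
Proof. by rewrite /stat_weight farC k_sym. Qed.

(** Since [k] vanishes on the near band, omitting that band affects only the centring term; it
    reappears as a correction of size N^-2 on near pairs. *)
Lemma stat_weightE i j :
  stat_weight i j = N^-1 * k i j - N^-1 ^+ 2 + N^-1 ^+ 2 * (~~ far i j)%:R.
Proof.
rewrite /stat_weight -/N; have [fij|fij] /= := boolP (far i j).
  by rewrite mulr0 addr0 exprVn mulrC.
by rewrite k_near// mulr0 mulr1 sub0r addNr.
Qed.

Let B0 : 0 <= B.
Proof. exact: le_trans (mu_ge0 (Ordinal n0)) (mu_le _). Qed.

Lemma near_sum_bounds i : 0 <= near_sum i <= 3 * B.
Proof.
rewrite sumr_ge0/= => [|j _]; last by rewrite mulr_ge0.
apply: (@le_trans _ _ (\sum_(j : 'I_n) (~~ far j i)%:R * B)).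
  by apply: ler_sum => j _; rewrite farC ler_wpM2l.
rewrite -mulr_suml ler_wpM2r//.
rewrite -natr_sum ler_nat; apply: leq_trans (card_near n i).
by rewrite -sum1_card [leqRHS]big_mkcond; apply: leq_sum => j _; rewrite inE.
Qed.

Let mu_sqr_le i : mu i ^+ 2 <= B ^+ 2.
Proof. by rewrite lerXn2r ?nnegrE. Qed.

(** An exact identity, from 2 mu_i mu_j = mu_i^2 + mu_j^2 - (mu_i - mu_j)^2. The three errors come
    from the omitted band, from the boundary deficit of the rows and from the oscillation of [mu]
    within the window. *)
Lemma emp_bias :
  \sum_i \sum_j stat_weight i j * mu i * mu j - emp_var =
  N^-1 ^+ 2 * (\sum_i mu i * near_sum i)
  - N^-1 * (\sum_i mu i ^+ 2 * (1 - s i))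
  - N^-1 * (\sum_i \sum_j k i j * (mu i - mu j) ^+ 2) / 2.
Proof.
have kmu : \sum_i \sum_j k i j * (mu i * mu j) =
    \sum_i mu i ^+ 2 * s i - (\sum_i \sum_j k i j * (mu i - mu j) ^+ 2) / 2.
  have T : \sum_i \sum_j k i j * mu j ^+ 2 = \sum_i mu i ^+ 2 * s i.
    rewrite exchange_big/=; apply: eq_bigr => j _.
    by rewrite /s mulr_sumr; apply: eq_bigr => i _; rewrite k_sym mulrC.
  (* The sum is halved so that one half can be rewritten through [T] as a sum of squares of mu_j. *)
  have -> : \sum_i mu i ^+ 2 * s i =
      2^-1 * \sum_i mu i ^+ 2 * s i + 2^-1 * \sum_i mu i ^+ 2 * s i.
    by field.
  rewrite -{2}T [X in _ - X]mulrC !mulr_sumr -big_split -sumrB/=.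
  apply: eq_bigr => i _; rewrite /s !mulr_sumr -big_split -sumrB/=.
  by apply: eq_bigr => j _; field.
have -> : \sum_i \sum_j stat_weight i j * mu i * mu j =
    N^-1 * (\sum_i \sum_j k i j * (mu i * mu j)) - average ^+ 2
    + N^-1 ^+ 2 * (\sum_i mu i * near_sum i).
  rewrite /average exprMn [(\sum_i mu i) ^+ 2]expr2 mulr_suml !mulr_sumr.
  rewrite -sumrB -big_split; apply: eq_bigr => i _ /=.
  rewrite /near_sum !mulr_sumr -sumrB -big_split; apply: eq_bigr => j _ /=.
  by rewrite stat_weightE /N; ring.
rewrite kmu emp_varE.
have -> : \sum_i mu i ^+ 2 * (1 - s i) =
    \sum_i mu i ^+ 2 - \sum_i mu i ^+ 2 * s i.
  by rewrite -sumrB; apply: eq_bigr => i _; ring.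
by ring.
Qed.

Let E_sqr i j : k i j * (mu i - mu j) ^+ 2 <= k i j * E ^+ 2.
Proof.
have [->|kij] := eqVneq (k i j) 0; first by rewrite !mul0r.
rewrite ler_wpM2l// -(real_normK (num_real (_ - _))).
have := mu_lip kij => le_E.
by rewrite lerXn2r// nnegrE//; exact: le_trans le_E.
Qed.

Lemma bias_le :
  `|\sum_i \sum_j stat_weight i j * mu i * mu j - emp_var| <=
  B ^+ 2 * ((2 * q + 3) / N) + E ^+ 2.
Proof.
have iN0 : 0 < N^-1 by rewrite invr_gt0.
have t1 : 0 <= N^-1 ^+ 2 * (\sum_i mu i * near_sum i) <= N^-1 * (3 * B ^+ 2).
  have S0 : 0 <= \sum_i mu i * near_sum i.
    by apply: sumr_ge0 => i _; rewrite mulr_ge0//; case/andP: (near_sum_bounds i).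
  rewrite mulr_ge0 ?sqr_ge0//= expr2 -mulrA ler_pM2l//.
  rewrite ler_pdivrMl// -sum_cst_n; apply: ler_sum => i _.
  have /andP[a b] := near_sum_bounds i.
  by rewrite expr2 mulrCA ler_pM.
have t2 : 0 <= N^-1 * (\sum_i mu i ^+ 2 * (1 - s i)) <= N^-1 * (B ^+ 2 * (2 * q)).
  have s1 i : 0 <= 1 - s i by rewrite subr_ge0 row_le1.
  rewrite mulr_ge0 ?(ltW iN0)//=; last first.
    by apply: sumr_ge0 => i _; rewrite mulr_ge0 ?sqr_ge0.
  rewrite ler_pM2l//; apply: le_trans (ler_wpM2l (sqr_ge0 B) deficit_le).
  rewrite mulr_sumr; by apply: ler_sum => i _; rewrite ler_wpM2r.
have t3 : 0 <= N^-1 * (\sum_i \sum_j k i j * (mu i - mu j) ^+ 2) <= E ^+ 2.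
  rewrite mulr_ge0 ?(ltW iN0)//=; last first.
    by do 2 (apply: sumr_ge0 => ? _); rewrite mulr_ge0 ?sqr_ge0.
  rewrite ler_pdivrMl// -sum_cst_n; apply: ler_sum => i _.
  apply: (@le_trans _ _ (\sum_j k i j * E ^+ 2)); first exact: ler_sum.
  by rewrite -mulr_suml -[leRHS]mul1r ler_wpM2r ?sqr_ge0.
rewrite emp_bias.
have -> : B ^+ 2 * ((2 * q + 3) / N) =
    N^-1 * (B ^+ 2 * (2 * q)) + N^-1 * (3 * B ^+ 2) by field.
move: t1 t2 t3 => /andP[? ?] /andP[? ?] /andP[? ?].
by rewrite ler_norml; apply/andP; split; lra.
Qed.

(** N times a row mean is a smoothing error, minus a boundary deficit, plus mu_i - [average], plus a
    band correction. The third piece makes the linear noise term scale with the empirical variance;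
    the factor 4 is the price of squaring four pieces. *)
Lemma sum_row_mean_sqr_le :
  \sum_i (\sum_j stat_weight i j * mu j) ^+ 2 <=
  4 / N * (E ^+ 2 + B ^+ 2 * (2 * q / N) + emp_var + 9 * B ^+ 2 / N).
Proof.
have iN0 : 0 < N^-1 by rewrite invr_gt0.
pose a i := \sum_j k i j * (mu j - mu i).
have gE i : \sum_j stat_weight i j * mu j =
    N^-1 * (a i - (1 - s i) * mu i + (mu i - average) + N^-1 * near_sum i).
  have -> : a i = \sum_j k i j * mu j - s i * mu i.
    by rewrite /a /s mulr_suml -sumrB; apply: eq_bigr => j _; ring.
  have -> : \sum_j stat_weight i j * mu j =
     N^-1 * (\sum_j k i j * mu j) - N^-1 * average + N^-1 ^+ 2 * near_sum i.
    rewrite /average /near_sum !mulr_sumr -sumrB -big_split/=.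
    by apply: eq_bigr => j _; rewrite stat_weightE /N; ring.
  by ring.
have aE i : a i ^+ 2 <= E ^+ 2.
  rewrite -(real_normK (num_real (a i))) lerXn2r ?nnegrE//.
  apply: (le_trans (ler_norm_sum _ _ _)).
  apply: (@le_trans _ _ (\sum_j k i j * E)); last first.
    by rewrite -mulr_suml -[leRHS]mul1r ler_wpM2r.
  apply: ler_sum => j _; rewrite normrM ger0_norm//.
  have [->|kij] := eqVneq (k i j) 0; first by rewrite !mul0r.
  by rewrite ler_wpM2l// distrC mu_lip.
(* As 1 - s_i lies between 0 and 1, its square is at most itself, so the bound on the total deficit
   can be used. *)
have bE i : ((1 - s i) * mu i) ^+ 2 <= B ^+ 2 * (1 - s i).
  have s1 : 0 <= 1 - s i by rewrite subr_ge0 row_le1.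
  have s0 : 1 - s i <= 1 by rewrite gerBl; apply: sumr_ge0.
  rewrite exprMn mulrC ler_pM ?sqr_ge0//.
  by rewrite expr2 -[leRHS]mulr1 ler_wpM2l.
have dE i : (N^-1 * near_sum i) ^+ 2 <= 9 * B ^+ 2 * N^-1.
  have /andP[d0 d1] := near_sum_bounds i.
  have iN1 : N^-1 <= 1 by rewrite invf_le1// /N ler1n.
  have d2 : near_sum i ^+ 2 <= (3 * B) ^+ 2.
    by rewrite lerXn2r ?nnegrE// mulr_ge0.
  have iN2 : N^-1 ^+ 2 <= N^-1.
    by rewrite expr2 -[leRHS]mulr1 ler_wpM2l// ltW.
  rewrite (_ : 9 * B ^+ 2 = (3 * B) ^+ 2); last by ring.
  by rewrite exprMn mulrC ler_pM ?sqr_ge0.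
have sqr4 (x y z t : R) :
    (x - y + z + t) ^+ 2 <= 4 * (x ^+ 2 + y ^+ 2 + z ^+ 2 + t ^+ 2).
  have := sqr_ge0 (x + y); have := sqr_ge0 (x - z); have := sqr_ge0 (x - t).
  have := sqr_ge0 (y + z); have := sqr_ge0 (y + t); have := sqr_ge0 (z - t).
  nra.
apply: (@le_trans _ _ (\sum_i (N^-1 ^+ 2 * (4 * (E ^+ 2 + B ^+ 2 * (1 - s i) +
    (mu i - average) ^+ 2 + 9 * B ^+ 2 * N^-1))))).
  apply: ler_sum => i _; rewrite gE exprMn ler_wpM2l ?sqr_ge0//.
  apply: le_trans (sqr4 _ _ _ _) _; rewrite ler_pM2l//.
  by rewrite lerD// lerD// lerD.
rewrite -mulr_sumr -mulr_sumr !big_split/= !sum_cst_n -mulr_sumr.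
have -> : \sum_i (mu i - average) ^+ 2 = N * emp_var.
  by rewrite /emp_var mulVKf.
apply: (@le_trans _ _ (N^-1 ^+ 2 * (4 * (N * E ^+ 2 + B ^+ 2 * (2 * q) +
    N * emp_var + N * (9 * B ^+ 2 / N))))).
  rewrite ler_wpM2l ?sqr_ge0// ler_pM2l// !lerD2r lerD2l.
  by rewrite ler_wpM2l ?sqr_ge0.
rewrite le_eqVlt; apply/orP; left; apply/eqP; by field.
Qed.

(** One factor of [k i j] squared is bounded by [kmax] and the other is summed along the row. With
    [kmax] of order 1/(n h) the result is of order 1/(n^2 h). *)
Lemma sum_sqr_weight_le :
  \sum_(p : 'I_n * 'I_n) stat_weight p.1 p.2 ^+ 2 <= 2 * kmax / N + 2 / N ^+ 2.
Proof.
rewrite -(pair_bigA _ (fun i j => stat_weight i j ^+ 2))/=.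
have iN0 : 0 < N^-1 by rewrite invr_gt0.
have iN0' := ltW iN0.
have kmax0 : 0 <= kmax by exact: le_trans (k_ge0 (Ordinal n0) (Ordinal n0)) _.
have w2 i j : stat_weight i j ^+ 2 <=
    2 * kmax * N^-1 ^+ 2 * k i j + 2 * (N^-1 ^+ 2) ^+ 2.
  have k2 : k i j ^+ 2 <= kmax * k i j by rewrite expr2 ler_wpM2r.
  rewrite /stat_weight; case: ifP => _; last first.
    by rewrite expr0n addr_ge0// !mulr_ge0.
  rewrite -/N -exprVn.
  apply: (@le_trans _ _ (2 * (N^-1 ^+ 2 * k i j ^+ 2) + 2 * (N^-1 ^+ 2) ^+ 2)).
    by have := sqr_ge0 (k i j / N + N^-1 ^+ 2); nra.
  by rewrite lerD2r; have := ler_wpM2l (sqr_ge0 N^-1) k2; lra.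
apply: (@le_trans _ _ (\sum_(i < n) \sum_(j < n)
    (2 * kmax * N^-1 ^+ 2 * k i j + 2 * (N^-1 ^+ 2) ^+ 2))).
  by apply: ler_sum => i _; exact: ler_sum.
apply: (@le_trans _ _ (\sum_(i < n)
    (2 * kmax * N^-1 ^+ 2 + N * (2 * (N^-1 ^+ 2) ^+ 2)))).
  apply: ler_sum => i _; rewrite big_split/= sum_cst_n lerD2r -mulr_sumr.
  by rewrite -[leRHS]mulr1 ler_wpM2l// !mulr_ge0// ltW.
rewrite sum_cst_n le_eqVlt; apply/orP; left; apply/eqP; by field.
Qed.
End bias.

(** * Comparison of the bandwidth with powers of the rate *)

Section rates.
Context (R : realType) (alpha beta Ch : R) (n : nat).
Hypotheses (n0 : (0 < n)%N) (a0 : 0 < alpha) (b0 : 0 < beta) (b1 : beta < 1 / 2).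
Hypothesis Ch1 : 1 <= Ch.
Let N : R := n%:R.
Let z := zeta alpha beta n.
Let h := bandwidth Ch beta n.
Let p := 2 / (4 * beta + 1).

Let N1 : 1 <= N. Proof. by rewrite ler1n. Qed.
Let N0 : 0 < N. Proof. by rewrite ltr0n. Qed.
Let NN : N != 0. Proof. by rewrite gt_eqF. Qed.
Let Ch0 : 0 < Ch. Proof. exact: lt_le_trans ltr01 Ch1. Qed.

Let pw_gt0 c : 0 < N `^ c. Proof. exact: powR_gt0. Qed.

Let powX (c : R) (m : nat) : (N `^ c) ^+ m = N `^ (c * m%:R).
Proof. by rewrite powRrM powR_mulrn// powR_ge0. Qed.

Lemma zeta_ge : [/\ N `^ (- (2 * alpha)) <= z, N `^ (- beta) <= z &
  N `^ (- (2 * beta / (4 * beta + 1))) <= z].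
Proof.
have := pw_gt0 (- (2 * alpha)); have := pw_gt0 (- beta).
have := pw_gt0 (- (2 * beta / (4 * beta + 1))).
by rewrite /z /zeta -/N; split; lra.
Qed.

Lemma zeta_gt0 : 0 < z.
Proof. by have [_ + _] := zeta_ge; exact: lt_le_trans. Qed.

Let z0 := zeta_gt0.

(** Each rate estimate thereby becomes a comparison of exponents with one chosen term of [zeta]. *)
Let le_zetaX (c e : R) (m : nat) : N `^ e <= z -> c <= e * m%:R -> N `^ c <= z ^+ m.
Proof.
move=> ez ce; apply: (@le_trans _ _ (N `^ (e * m%:R))); first exact: ler_powR.
by rewrite -powX lerXn2r// nnegrE ltW.
Qed.

Lemma invn_le_zeta2 : N^-1 <= z ^+ 2.
Proof.
have [_ zb _] := zeta_ge.
by rewrite -powR_inv1 ?(ltW N0)//; apply: (le_zetaX zb); have := b1; lra.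
Qed.

Lemma invn2_le_zeta : N^-1 ^+ 2 <= z.
Proof.
have [_ zb _] := zeta_ge.
rewrite exprVn -powR_invn ?(ltW N0)//; apply: le_trans zb.
by apply: ler_powR => //; have := b1; lra.
Qed.

Let den0 : 0 < 4 * beta + 1. Proof. by have := b0; lra. Qed.
Let pE : p * (4 * beta + 1) = 2.
Proof. by rewrite /p divfK// gt_eqF. Qed.
Let pbE : 2 * beta / (4 * beta + 1) = p * beta.
Proof. by rewrite /p; field; rewrite gt_eqF. Qed.
Let p0 : 0 < p. Proof. by rewrite divr_gt0. Qed.

Lemma bandwidth_gt0 : 0 < h.
Proof. by rewrite mulr_gt0. Qed.

(* The exponent of the bandwidth is [Num.min p 1] with [p = 2 / (4 beta + 1)],
   and [p <= 1] exactly when [beta >= 1/4]. *)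
Lemma bandwidth_le_zeta2 : h <= Ch * z ^+ 2.
Proof.
have [_ zb zp] := zeta_ge; rewrite /h /bandwidth -/N -/p ler_pM2l//.
rewrite pbE in zp.
by rewrite minEle; case: ifP => _; [apply: (le_zetaX zp)|apply: (le_zetaX zb)];
  have := b0; have := b1; have := p0; have := pE; nra.
Qed.

(** The power of n in h^beta is exactly one of the last two terms of [zeta], depending on which
    exponent the minimum selects; the remaining factor is at most [Ch], because [Ch] is at least 1
    and beta at most 1. *)
Lemma bandwidth_powR_le_zeta : h `^ beta <= Ch * z.
Proof.
have [_ zb zp] := zeta_ge; rewrite /h /bandwidth -/N -/p.
rewrite powRM ?(ltW Ch0) ?powR_ge0// ler_pM ?powR_ge0//.
  by rewrite ler1_powR//; have := b1; lra.
rewrite -powRrM mulNr; rewrite pbE in zp.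
by rewrite minEle; case: ifP => _//; rewrite mul1r.
Qed.

(** For p <= 1 the relation p (4 beta + 1) = 2 balances h^(4 beta) against 1/(n^2 h). For p > 1 one
    has beta < 1/4, and 1/n is at most n^(-4 beta). *)
Lemma invn2h_le_zeta4 : (N ^+ 2 * h)^-1 <= z ^+ 4.
Proof.
have [_ zb zp] := zeta_ge; rewrite /h /bandwidth -/N -/p; rewrite pbE in zp.
set e := Num.min p 1.
have -> : (N ^+ 2 * (Ch * N `^ (- e)))^-1 = Ch^-1 * N `^ (e - 2).
  rewrite powRB ?NN ?implybT// powR_mulrn ?(ltW N0)// powRN.
  by field; rewrite !gt_eqF.
apply: (@le_trans _ _ (1 * N `^ (e - 2))).
  by rewrite ler_pM2r// invf_le1.
rewrite mul1r /e minEle; case: (leP p 1) => pl.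
  by apply: (le_zetaX zp); have := pE; lra.
by apply: (le_zetaX zb); have := pE; have := b0; nra.
Qed.

(** Capping the exponent at 1 keeps at least [Ch] grid steps inside the bandwidth. *)
Lemma n_bandwidth_ge : Ch <= N * h.
Proof.
rewrite /h /bandwidth -/N -/p mulrCA ler_peMr ?(ltW Ch0)//.
rewrite -[X in X * _]powRr1 ?(ltW N0)// -powRD ?NN ?implybT//.
rewrite -[leLHS](powRr0 N); apply: ler_powR => //.
by rewrite minEle; case: (leP p 1) => pl; rewrite ?subrr// subr_ge0.
Qed.

End rates.

(** * Consequences of Hoelder smoothness on the grid *)

Section hoelder.
Context (R : realType) (alpha M : R) (f : R -> R) (n : nat).
Hypotheses (n0 : (0 < n)%N) (fH : holder alpha M f).

Lemma xpt_itv i : (i <= n)%N -> xpt R n i \in `[0, 1].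
Proof.
move=> i_n; rewrite in_itv/= /xpt divr_ge0//= ler_pdivrMr ?ltr0n// mul1r.
by rewrite ler_nat.
Qed.

Lemma holder_norm_le x : x \in `[0, 1] -> `|f x| <= M.
Proof. by move=> x01; have [_ [+ _]] := fH => /(_ 0%N (leq0n _) x x01). Qed.

Lemma holder_small x y : 0 < alpha < 1 -> x \in `[0, 1] -> y \in `[0, 1] ->
  `|f x - f y| <= M * `|x - y| `^ alpha.
Proof.
move=> /andP[a0 a1] x01 y01; have [_ [_ +]] := fH.
have -> : Num.truncn alpha = 0%N by apply/truncn0Pn; rewrite -ltNge.
by move=> /(_ x y x01 y01); rewrite subr0.
Qed.

Lemma holder_lipschitz x y : 1 <= alpha -> x \in `[0, 1] -> y \in `[0, 1] ->
  x <= y -> `|f y - f x| <= M * (y - x).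
Proof.
move=> a1; rewrite !in_itv/= => /andP[x0 x1] /andP[y0 y1] xy.
have t1 : (0 < Num.truncn alpha)%N by rewrite truncn_gt0.
have [fd [fb _]] := fH.
have df t : t \in `[x, y] -> derivable f t 1.
  rewrite in_itv/= => /andP[xt ty]; apply: (fd 0%N t1).
  by rewrite in_itv/= (le_trans x0 xt) (le_trans ty y1).
have [|t] := @MVT_segment _ f (derive1 f) _ _ xy _ (derivable_within_continuous df).
  move=> t txy; rewrite derive1E; apply/derivableP/df.
  exact: subset_itv_oo_cc txy.
rewrite in_itv/= => /andP[xt ty] ->.
rewrite normrM [`|y - x|]ger0_norm ?subr_ge0// ler_wpM2r ?subr_ge0//.
have := fb 1%N t1 t; rewrite derive1n1; apply.
by rewrite in_itv/= (le_trans x0 xt) (le_trans ty y1).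
Qed.

(** Below smoothness 1 the Hoelder bound gives n^(-2 alpha), above it the Lipschitz bound gives
    n^-2. The minimum with 1 also yields a bound free of z, since [zeta] may exceed 1. *)
Lemma holder_increment_sqr_le z i : 0 < alpha -> (i < n)%N ->
  n%:R `^ (- (2 * alpha)) <= z -> n%:R^-1 ^+ 2 <= z ->
  (f (xpt R n i.+1) - f (xpt R n i)) ^+ 2 <= M ^+ 2 * Num.min z 1.
Proof.
move=> a0 i_n az nz; set x := xpt R n i; set y := xpt R n i.+1.
have N0 : 0 < n%:R :> R by rewrite ltr0n.
have N1 : 1 <= n%:R :> R by rewrite ler1n.
have yx : y - x = n%:R^-1 by rewrite /x /y /xpt -mulrBl -natr1 addrC addKr mul1r.
have x01 : x \in `[0, 1] by apply: xpt_itv; exact: ltnW.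
have y01 : y \in `[0, 1] by exact: xpt_itv.
have M0 : 0 <= M by exact: le_trans (holder_norm_le x01).
suff [e e_le fe] : exists2 e : R, 0 <= e & `|f y - f x| <= M * e /\ e ^+ 2 <= Num.min z 1.
  have [fe1 fe2] := fe.
  rewrite -(real_normK (num_real (f y - f x))).
  apply: (@le_trans _ _ ((M * e) ^+ 2)); first by rewrite lerXn2r ?nnegrE// mulr_ge0.
  by rewrite exprMn ler_wpM2l ?sqr_ge0.
have [a1|a1] := ltP alpha 1.
  exists (n%:R `^ (- alpha)); first exact: powR_ge0.
  have := @holder_small y x; rewrite a0 a1 yx => /(_ isT y01 x01).
  rewrite [`|_^-1|]ger0_norm ?invr_ge0 ?(ltW N0)// -(powR_inv1 (ltW N0)) -powRrM mulN1r => ->.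
  split => //; rewrite -powR_mulrn ?powR_ge0// -powRrM mulNr [alpha * 2]mulrC.
  rewrite le_min az/= -[leRHS](powRr0 n%:R); apply: ler_powR => //; lra.
exists n%:R^-1; first by rewrite invr_ge0 ltW.
split; first by rewrite -yx holder_lipschitz// -subr_ge0 yx invr_ge0 ltW.
by rewrite le_min nz/= expr_le1 ?invr_ge0 ?(ltW N0)// invf_le1.
Qed.
End hoelder.

(** * Splitting the statistic into constant, linear and quadratic parts *)

Section decomposition.
Context (R : realType) (K : R -> R) (h : R) (n : nat).

Definition kweight (i j : 'I_n) := pair_weight K n h i j.

Lemma kweight_sym i j : kweight i j = kweight j i.
Proof. by rewrite /kweight /pair_weight addnC. Qed.

Lemma That_weightE y : That K h n y =
  \sum_i \sum_j stat_weight kweight i j * (y i.+1 - y i) ^+ 2 * (y j.+1 - y j) ^+ 2.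
Proof.
rewrite /That !mulr_sumr -sumrB; apply: eq_bigr => i _.
rewrite !mulr_sumr !(big_mkcond (fun j : 'I_n => _ <= _)) -sumrB/=.
apply: eq_bigr => j _; rewrite norm_natrB ler_nat -far_dist /stat_weight.
case: ifP => _; last by rewrite subrr !mul0r.
by rewrite Knh_pair_weight -/(kweight i j); ring.
Qed.

Lemma weighted_sum_centered (a : 'I_n -> 'I_n -> R) (mu Z : 'I_n -> R) :
  (forall i j, a i j = a j i) ->
  \sum_i \sum_j a i j * (Z i + mu i) * (Z j + mu j) =
  \sum_i \sum_j a i j * mu i * mu j +
  (\sum_(p : 'I_n * 'I_n) a p.1 p.2 * (Z p.1 * Z p.2) +
   \sum_i (2 * \sum_j a i j * mu j) * Z i).
Proof.
move=> a_sym.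
rewrite -(pair_bigA _ (fun i j => a i j * (Z i * Z j)))/=.
have T : \sum_i \sum_j a i j * mu i * Z j = \sum_i \sum_j a i j * mu j * Z i.
  rewrite exchange_big/=; apply: eq_bigr => j _; apply: eq_bigr => i _.
  by rewrite a_sym.
have -> : \sum_i (2 * \sum_j a i j * mu j) * Z i =
    \sum_i \sum_j a i j * mu i * Z j + \sum_i \sum_j a i j * mu j * Z i.
  rewrite T -big_split; apply: eq_bigr => i _ /=.
  by rewrite -mulr_suml; ring.
rewrite -!big_split; apply: eq_bigr => i _ /=.
by rewrite -!big_split; apply: eq_bigr => j _ /=; ring.
Qed.
End decomposition.

Section constants.
Context (R : realType) (Cxi ku M Ch : R).

(* [cA] bounds the squared increments of [f] and the values of [V], [cB] bounds
   [E R_i^2], [cL * zeta] bounds its oscillation within one bandwidth, and [cZ]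
   bounds the variance of [R_i^2]. *)
Definition cA := M ^+ 2 + M.
Definition cB := 3 * cA.
Definition cL := M ^+ 2 + 2 * (M * Ch).
Definition cZ := centered_sqr_bound Cxi cA.
(** This and the next two are the coefficients of [mean_That_bias] and [That_noise_second_moment];
    all are free of alpha, beta and n. *)
Definition cBias := cB ^+ 2 * (2 * Ch + 3) + cL ^+ 2.
Definition cVar0 := 72 * cZ ^+ 2 * (4 * ku + 2)
  + 96 * cZ * (cL ^+ 2 + 2 * cB ^+ 2 * Ch + 9 * cB ^+ 2).
Definition cVar1 := 96 * cZ.
End constants.

(** * Bias and noise bounds shared by the null and the alternative *)

Section statistic.
Context (R : realType) (Cxi kl ku M Ch : R) (K : R -> R).
Hypotheses (kl0 : 0 < kl) (klu : kl <= ku) (hK : is_kernel kl ku K).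
Hypotheses (M1 : 1 <= M) (Ch2 : 2 <= Ch) (Ch8 : 8 * ku <= Ch).
Context (alpha beta : R) (n : nat).
Hypotheses (a0 : 0 < alpha) (b0 : 0 < beta) (b1 : beta < 1 / 2) (n0 : (0 < n)%N).
Let z := zeta alpha beta n.
Let h := bandwidth Ch beta n.
Context (f V : R -> R).
Hypothesis fH : holder alpha M f.
Hypothesis V_bounds : forall i, (i <= n)%N -> 0 <= V (xpt R n i) <= M.
Hypothesis V_lip : forall i j, (i <= n)%N -> (j <= n)%N ->
  `|i%:R - j%:R : R| < n%:R * h ->
  `|V (xpt R n i) - V (xpt R n j)| <= M * Ch * z.

Let delta i := f (xpt R n i.+1) - f (xpt R n i).
Let s i := Num.sqrt (V (xpt R n i)).
Definition sq_mean (i : nat) := incr_mean delta s i.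

Let Ch1 : 1 <= Ch. Proof. by have := Ch2; lra. Qed.
Let M0 : 0 <= M. Proof. by have := M1; lra. Qed.
Let z0 : 0 < z. Proof. exact: zeta_gt0. Qed.

Lemma delta_sqr_le i : (i < n)%N -> delta i ^+ 2 <= M ^+ 2 * z /\ delta i ^+ 2 <= M ^+ 2.
Proof.
move=> i_n; have [za zb _] := zeta_ge alpha beta n0.
have := holder_increment_sqr_le n0 fH a0 i_n za (invn2_le_zeta alpha n0 b1).
rewrite -/(delta i) => H; have M2 := sqr_ge0 M.
have m1 : M ^+ 2 * Num.min z 1 <= M ^+ 2 * z by rewrite ler_wpM2l// ge_min lexx.
have m2 : M ^+ 2 * Num.min z 1 <= M ^+ 2 * 1.
  by rewrite ler_wpM2l// ge_min lexx orbT.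
by rewrite mulr1 in m2; split; [exact: le_trans m1|exact: le_trans m2].
Qed.

Let s_sqr i : (i <= n)%N -> s i ^+ 2 = V (xpt R n i).
Proof. by move=> /V_bounds/andP[V0 _]; rewrite sqr_sqrtr. Qed.

Lemma sq_meanE i : (i < n)%N ->
  sq_mean i = delta i ^+ 2 + V (xpt R n i) + V (xpt R n i.+1).
Proof. by move=> i_n; rewrite /sq_mean /incr_mean !s_sqr// ltnW. Qed.

Lemma sq_mean_bounds i : (i < n)%N -> 0 <= sq_mean i <= cB M.
Proof.
move=> i_n; rewrite sq_meanE//; have [_ d2] := delta_sqr_le i_n.
have /andP[? ?] := V_bounds (ltnW i_n); have /andP[? ?] := V_bounds i_n.
have := sqr_ge0 (delta i); have := sqr_ge0 M; have := M0; rewrite /cB /cA.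
by move=> ? ? ?; apply/andP; split; lra.
Qed.

(** Two squared increments of f both lie between 0 and M^2 z, hence differ by at most M^2 z; V is
    compared twice, at the pair and at the pair shifted by one. *)
Lemma sq_mean_lip i j : (i < n)%N -> (j < n)%N -> `|i%:R - j%:R : R| < n%:R * h ->
  `|sq_mean i - sq_mean j| <= cL M Ch * z.
Proof.
move=> i_n j_n ij; rewrite !sq_meanE//.
have [di _] := delta_sqr_le i_n; have [dj _] := delta_sqr_le j_n.
have := V_lip (ltnW i_n) (ltnW j_n) ij.
have ij1 : `|i.+1%:R - j.+1%:R : R| < n%:R * h.
  by rewrite -!natr1 opprD addrACA subrr addr0.
have := V_lip i_n j_n ij1.
have := sqr_ge0 (delta i); have := sqr_ge0 (delta j).
rewrite /cL; move: (delta i ^+ 2) (delta j ^+ 2) di dj => x y.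
rewrite !ler_norml => ? ? ? ? /andP[? ?] /andP[? ?]; apply/andP; split; lra.
Qed.

Let q := n%:R * h.
Let h0 : 0 < h. Proof. exact: bandwidth_gt0. Qed.
Let qCh : Ch <= q. Proof. exact: n_bandwidth_ge. Qed.
Let q2 : 2 <= q. Proof. exact: le_trans Ch2 qCh. Qed.
Let q0 : 0 < q. Proof. exact: lt_le_trans q2. Qed.
Let q8 : 8 * ku <= q. Proof. exact: le_trans Ch8 qCh. Qed.
Let N0 : 0 < n%:R :> R. Proof. by rewrite ltr0n. Qed.

Let mu (i : 'I_n) := sq_mean i.
Let k := @kweight R K h n.

Let k_near (i j : 'I_n) : ~~ far i j -> k i j = 0.
Proof.
move=> ij; rewrite /k /kweight /pair_weight.
rewrite (lag_weightE kl0 klu hK h0 (erefl q) q2).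
by rewrite -far_dist (negbTE ij).
Qed.

Let k_lip (i j : 'I_n) : k i j != 0 -> `|mu i - mu j| <= cL M Ch * z.
Proof.
move=> kij; apply: sq_mean_lip => //; rewrite ltNge; apply/negP => qij.
move: kij; rewrite /k /kweight /pair_weight.
rewrite (lag_weight_far kl0 klu hK h0 (erefl q) q2) ?eqxx//.
by rewrite -norm_natrB.
Qed.

Let k_ge0 i j : 0 <= k i j.
Proof. exact: (lag_weight_ge0 kl0 klu hK h0 (erefl q) q2 q8). Qed.

Let k_le i j : k i j <= 2 * ku / q.
Proof. exact: (lag_weight_le kl0 klu hK h0 (erefl q) q2 q8). Qed.

Let row_le1 i : \sum_j k i j <= 1.
Proof. exact: (row_sum_le1 kl0 klu hK n0 h0 (erefl q) q2 q8). Qed.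

Let deficit_le : \sum_i (1 - \sum_j k i j) <= 2 * q.
Proof. exact: (total_deficit_le kl0 klu hK n0 h0 (erefl q) q2 q8). Qed.

Let mu_ge0 i : 0 <= mu i.
Proof. by have /andP[] := sq_mean_bounds (ltn_ord i). Qed.

Let mu_le i : mu i <= cB M.
Proof. by have /andP[] := sq_mean_bounds (ltn_ord i). Qed.

Let cL_ge0 : 0 <= cL M Ch.
Proof.
have := M0; have := Ch1 => C1 m0.
by rewrite /cL addr_ge0 ?sqr_ge0// !mulr_ge0//; lra.
Qed.

Let Lz0 : 0 <= cL M Ch * z. Proof. by rewrite mulr_ge0// ltW. Qed.

Let invn_z : n%:R^-1 <= z ^+ 2. Proof. exact: invn_le_zeta2. Qed.

Let qn_z : 2 * q / n%:R <= 2 * Ch * z ^+ 2.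
Proof.
rewrite /q mulrCA [n%:R * _]mulrC mulfK ?gt_eqF// -mulrA ler_pM2l//.
exact: bandwidth_le_zeta2.
Qed.

Definition sq_mean_var := emp_var mu.
Definition mean_That := \sum_i \sum_j stat_weight k i j * mu i * mu j.

Lemma mean_That_bias : `|mean_That - sq_mean_var| <= cBias M Ch * z ^+ 2.
Proof.
apply: (le_trans (bias_le n0 k_ge0 (@kweight_sym _ _ _ _) k_near row_le1
  deficit_le Lz0 mu_ge0 mu_le k_lip)).
rewrite [(_ * z) ^+ 2]exprMn /cBias [leRHS]mulrDl lerD2r -[leRHS]mulrA ler_wpM2l ?sqr_ge0//.
have := qn_z; have := invn_z; rewrite !mulrDl; lra.
Qed.

Let delta_le i : (i < n)%N -> delta i ^+ 2 <= cA M.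
Proof.
move=> /delta_sqr_le[_ d2]; apply: le_trans d2 _.
by rewrite lerDl.
Qed.

Let s_le i : (i <= n)%N -> s i ^+ 2 <= cA M.
Proof.
move=> i_n; rewrite s_sqr//; have /andP[_ VM] := V_bounds i_n.
by apply: le_trans VM _; rewrite lerDr sqr_ge0.
Qed.

Let row_mean_z : \sum_i (2 * \sum_j stat_weight k i j * mu j) ^+ 2 <=
  16 * z ^+ 2 * ((cL M Ch ^+ 2 + 2 * cB M ^+ 2 * Ch + 9 * cB M ^+ 2) * z ^+ 2
    + sq_mean_var).
Proof.
have := sum_row_mean_sqr_le n0 k_ge0 k_near row_le1
  deficit_le Lz0 mu_ge0 mu_le k_lip.
under [X in _ -> X <= _]eq_bigr do rewrite exprMn.
rewrite -mulr_sumr -/sq_mean_var => H.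
apply: (@le_trans _ _ (4 * (4 * z ^+ 2 * ((cL M Ch * z) ^+ 2 +
  cB M ^+ 2 * (2 * Ch * z ^+ 2) + sq_mean_var + 9 * cB M ^+ 2 * z ^+ 2)))); last first.
  by rewrite le_eqVlt; apply/orP; left; apply/eqP; ring.
have -> : 2 ^+ 2 = 4 :> R by rewrite -natrX.
rewrite ler_pM2l//; apply: (le_trans H).
have B2 := sqr_ge0 (cB M).
have v0 := emp_var_ge0 mu.
have iN0 : 0 <= n%:R^-1 :> R by rewrite invr_ge0 ltW.
have qN0 : 0 <= 2 * q / n%:R by exact: divr_ge0 (mulr_ge0 (ler0n _ _) (ltW q0)) (ltW N0).
apply: ler_pM.
- by rewrite mulr_ge0.
- apply: addr_ge0 (addr_ge0 (addr_ge0 (sqr_ge0 _) (mulr_ge0 B2 qN0)) v0) _.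
  exact: mulr_ge0 (mulr_ge0 (ler0n _ _) B2) iN0.
- by rewrite ler_pM2l.
- apply: lerD (lerD (lerD _ _) _) _ => //; first by rewrite ler_wpM2l.
  by apply: ler_wpM2l invn_z; exact: mulr_ge0.
Qed.

Let weight_z : \sum_(p : 'I_n * 'I_n) stat_weight k p.1 p.2 ^+ 2 <=
  (4 * ku + 2) * z ^+ 4.
Proof.
apply: (le_trans (sum_sqr_weight_le n0 k_ge0 k_le row_le1)).
rewrite [leRHS]mulrDl; apply: lerD.
  have -> : 2 * (2 * ku / q) / n%:R = 4 * ku * (n%:R ^+ 2 * h)^-1.
    by rewrite /q; field; rewrite !gt_eqF.
  rewrite ler_wpM2l//; last exact: invn2h_le_zeta4.
  by rewrite mulr_ge0// (le_trans (ltW kl0)).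
rewrite ler_pM2l// -exprVn (_ : z ^+ 4 = (z ^+ 2) ^+ 2); last by rewrite -exprM.
by rewrite lerXn2r ?nnegrE ?sqr_ge0// invr_ge0 ltW.
Qed.

Context d (Om : measurableType d) (P : probability Om R) (xi : 'I_n.+1 -> Om -> R).
Hypothesis iid : iid_noise Cxi P xi.

Definition That_noise w :=
  \sum_(p : 'I_n * 'I_n) stat_weight k p.1 p.2 *
    (centered_sqr xi delta s p.1 w * centered_sqr xi delta s p.2 w) +
  \sum_(i < n) (2 * \sum_j stat_weight k i j * mu j) * centered_sqr xi delta s i w.

Lemma That_decomposition w :
  That K h n (Yobs f V xi w) = mean_That + That_noise w.
Proof.
rewrite That_weightE /mean_That /That_noise -weighted_sum_centered; last first.
  by move=> i j; apply: stat_weight_sym => ? ?; exact: kweight_sym.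
apply: eq_bigr => i _; apply: eq_bigr => j _.
rewrite /centered_sqr -/(sq_mean _) !subrK /increment /Yobs /delta /s.
congr (_ * _ ^+ 2 * _ ^+ 2); ring.
Qed.

Lemma That_noise_second_moment : L2 P That_noise /\
  mean P (fun w => That_noise w ^+ 2) <=
  cVar0 Cxi ku M Ch * z ^+ 4 + cVar1 Cxi M * z ^+ 2 * sq_mean_var.
Proof.
have far0 (p : 'I_n * 'I_n) : ~~ far p.1 p.2 -> stat_weight k p.1 p.2 = 0.
  by rewrite /stat_weight; case: ifP.
have [LT mT] := quadratic_form_second_moment iid delta_le s_le
  (fun i => 2 * \sum_j stat_weight k i j * mu j) n0 far0.
split=> //; apply: (le_trans mT).
have Z0 : 0 <= cZ Cxi M by exact: (centered_sqr_bound_ge0 iid delta_le s_le n0).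
have w1 := ler_wpM2l (mulr_ge0 (ler0n R 72) (sqr_ge0 (cZ Cxi M))) weight_z.
have w2 := ler_wpM2l (mulr_ge0 (ler0n R 6) Z0) row_mean_z.
apply: le_trans (lerD w1 w2) _.
by rewrite le_eqVlt; apply/orP; left; apply/eqP; rewrite /cVar0 /cVar1; ring.
Qed.

End statistic.

(** * Error probabilities of the test *)

Section error_bounds.
Context (R : realType) (Cxi kl ku M Ch : R) (K : R -> R).
Hypotheses (kl0 : 0 < kl) (klu : kl <= ku) (hK : is_kernel kl ku K).
Hypotheses (M1 : 1 <= M) (Ch2 : 2 <= Ch) (Ch8 : 8 * ku <= Ch) (Cxi0 : 0 <= Cxi).
Context (alpha beta : R) (n : nat).
Hypotheses (a0 : 0 < alpha) (b0 : 0 < beta) (b1 : beta < 1 / 2) (n0 : (0 < n)%N).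
Let z := zeta alpha beta n.
Let h := bandwidth Ch beta n.
Context (f V : R -> R).
Hypothesis fH : holder alpha M f.
Context d (Om : measurableType d) (P : probability Om R) (xi : 'I_n.+1 -> Om -> R).
Hypothesis iid : iid_noise Cxi P xi.
Let T w := That K h n (Yobs f V xi w).
Let C1 := cBias M Ch.
Let C3 := cVar0 Cxi ku M Ch.
Let C4 := cVar1 Cxi M.
Let N0 : 0 < n%:R :> R. Proof. by rewrite ltr0n. Qed.
Let M0 : 0 <= M. Proof. exact: le_trans ler01 M1. Qed.
Let z0 : 0 < z. Proof. exact: zeta_gt0. Qed.
Let Ch0 : 0 <= Ch. Proof. by apply: le_trans Ch2. Qed.
Let ku0 : 0 <= ku. Proof. by apply: le_trans klu; exact: ltW. Qed.

Lemma cZ_ge0 : 0 <= cZ Cxi M.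
Proof.
apply: mulr_ge0; first by rewrite mulr_ge0 ?sqr_ge0.
by rewrite addr_ge0// mulr_ge0.
Qed.

Lemma cVar1_ge0 : 0 <= C4.
Proof. by rewrite mulr_ge0// cZ_ge0. Qed.

Lemma cVar0_ge0 : 0 <= C3.
Proof.
have Z0 := cZ_ge0; have B2 := sqr_ge0 (cB M).
apply: addr_ge0; apply: mulr_ge0.
- by rewrite mulr_ge0 ?sqr_ge0.
- by rewrite addr_ge0// mulr_ge0.
- exact: mulr_ge0.
- by rewrite addr_ge0 ?[0 <= 9 * _]mulr_ge0// addr_ge0 ?sqr_ge0// mulr_ge0// mulr_ge0.
Qed.

(** The threshold adds the bias, the null value of v and a margin [X]; relative to the squared
    margin the second moment is a constant over [X ^+ 2]. *)
Lemma type_I_error_le (X : R) : 0 < X -> D0 M n V ->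
  fine (P [set w | (C1 + M ^+ 4 + X) * z ^+ 2 < T w])
    <= (C3 + C4 * M ^+ 4) / X ^+ 2.
Proof.
move=> X0 [_ [s2 [s20 [s2M Vs]]]].
have V_bounds i : (i <= n)%N -> 0 <= V (xpt R n i) <= M.
  by move=> /Vs ->; rewrite s20.
have V_lip i j : (i <= n)%N -> (j <= n)%N -> `|i%:R - j%:R : R| < n%:R * h ->
    `|V (xpt R n i) - V (xpt R n j)| <= M * Ch * z.
  by move=> /Vs -> /Vs -> _; rewrite subrr normr0 !mulr_ge0// ltW.
set v := sq_mean_var n f V.
have v_le : v <= M ^+ 4 * z ^+ 2.
  (* Subtracting the constant noise level 2 s2 leaves only the squared increment of f in each
     mean. *)
  apply: (le_trans (emp_var_min _ n0 (2 * s2))).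
  rewrite ler_pdivrMl// (_ : n%:R * _ = \sum_(i < n) (M ^+ 4 * z ^+ 2)); last first.
    by rewrite sumr_const card_ord mulr_natl.
  apply: ler_sum => i _.
  rewrite (sq_meanE _ V_bounds)// !Vs//; last exact: ltnW.
  set e := (f _ - f _) ^+ 2; have [e1 _] := delta_sqr_le a0 b1 n0 fH (ltn_ord i).
  have -> : e + s2 + s2 - 2 * s2 = e by ring.
  rewrite (_ : M ^+ 4 * z ^+ 2 = (M ^+ 2 * z) ^+ 2); last by ring.
  by rewrite lerXn2r ?nnegrE ?sqr_ge0// mulr_ge0 ?sqr_ge0// ltW.
have := mean_That_bias kl0 klu hK M1 Ch2 Ch8 a0 b0 b1 n0 fH V_bounds V_lip.
have [LX mX] := That_noise_second_moment kl0 klu hK M1 Ch2 Ch8 a0 b0 b1 n0 fH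
  V_bounds V_lip iid.
rewrite -/C1 -/C3 -/C4 -/v -/z in mX *; rewrite ler_norml => /andP[_ mb].
have z2 : 0 < z ^+ 2 by rewrite exprn_gt0.
have tm : mean_That Ch K beta n f V + X * z ^+ 2 <= (C1 + M ^+ 4 + X) * z ^+ 2.
  by lra.
have := chebyshev_gt LX (mulr_gt0 X0 z2) tm.
under [X in fine (P X) <= _ -> _]eq_set => w do rewrite -That_decomposition.
move=> H; apply: (le_trans H).
rewrite ler_pdivrMr ?exprn_gt0 ?mulr_gt0//; apply: (le_trans mX).
have -> : (C3 + C4 * M ^+ 4) / X ^+ 2 * (X * z ^+ 2) ^+ 2 =
    C3 * z ^+ 4 + C4 * z ^+ 2 * (M ^+ 4 * z ^+ 2).
  by field; rewrite gt_eqF.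
rewrite lerD2l ler_wpM2l// mulr_ge0 ?sqr_ge0//; exact: cVar1_ge0.
Qed.

Lemma holder_bounds : holder beta M V -> (forall x, x \in `[0, 1] -> 0 <= V x) ->
  forall i, (i <= n)%N -> 0 <= V (xpt R n i) <= M.
Proof.
move=> VH V0 i i_n; have x01 := xpt_itv R n0 i_n.
by rewrite V0//= (le_trans (ler_norm _))// (holder_norm_le VH).
Qed.

Lemma holder_bandwidth_lip : holder beta M V ->
  forall i j, (i <= n)%N -> (j <= n)%N -> `|i%:R - j%:R : R| < n%:R * h ->
    `|V (xpt R n i) - V (xpt R n j)| <= M * Ch * z.
Proof.
move=> VH i j i_n j_n ij.
have b01 : 0 < beta < 1 by rewrite b0 /=; have := b1; lra.
apply: (le_trans (holder_small VH b01 (xpt_itv R n0 i_n) (xpt_itv R n0 j_n))).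
rewrite -mulrA ler_wpM2l//.
have Ch1 : 1 <= Ch by have := Ch2; lra.
apply: le_trans (bandwidth_powR_le_zeta alpha n0 b0 b1 Ch1).
have h0 : 0 < h by exact: bandwidth_gt0.
apply: ge0_ler_powR; rewrite ?nnegrE ?(ltW b0)// ?(ltW h0)//.
rewrite /xpt -mulrBl normrM [`|_^-1|]ger0_norm ?invr_ge0//.
by rewrite ler_pdivrMr// mulrC ltW.
Qed.

(** Each mean is 2 V(x_i) up to O(z), so the dispersion of V passes to the means. The separation
    concerns n+1 values of V and there are only n means; the dropped endpoint costs O(1/n), hence
    O(z^2). *)
Lemma emp_var_lower (C : R) : 0 <= C -> D1 beta M n (C * z) V ->
  (2 * C ^+ 2 - 2 * (M + cB M) ^+ 2 - cL M Ch ^+ 2) * z ^+ 2 <= sq_mean_var n f V.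
Proof.
move=> C0 [VH [Vge0 VD]].
have V_bounds := holder_bounds VH Vge0; have V_lip := holder_bandwidth_lip VH.
have Ch1 : 1 <= Ch by have := Ch2; lra.
pose mu (i : 'I_n) := sq_mean n f V i.
(* Twice this centre is the average of the means, and the dispersion of V about it is at least the
   one about [Vbar]. *)
pose c := average mu / 2.
have iN0 : 0 <= n%:R^-1 :> R by rewrite invr_ge0.
have mu_bounds (i : 'I_n) : 0 <= mu i <= cB M.
  exact: (sq_mean_bounds M1 a0 b1 n0 fH V_bounds).
have c_bounds : 0 <= c <= cB M.
  have av0 : 0 <= average mu.
    by rewrite mulr_ge0// sumr_ge0// => i _; have /andP[] := mu_bounds i.
  have avB : average mu <= cB M.
    rewrite ler_pdivrMl// (_ : n%:R * _ = \sum_(i < n) cB M); last first.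
      by rewrite sumr_const card_ord mulr_natl.
    by apply: ler_sum => i _; have /andP[] := mu_bounds i.
  by rewrite /c; apply/andP; split; lra.
pose W i := (V (xpt R n i) - c) ^+ 2.
have W_total : n.+1%:R * (C * z) ^+ 2 <= \sum_(i < n.+1) W i.
  have : (C * z) ^+ 2 <= (n.+1%:R)^-1 * \sum_(i < n.+1) (V (xpt R n i) - Vbar n V) ^+ 2.
    rewrite -[leRHS]sqr_sqrtr; last first.
      by rewrite mulr_ge0 ?invr_ge0// sumr_ge0// => i _; exact: sqr_ge0.
    by rewrite lerXn2r ?nnegrE ?sqrtr_ge0// mulr_ge0// ltW.
  move=> H; rewrite -ler_pdivlMl ?ltr0n//; apply: (le_trans H).
  exact: (emp_var_min (fun i : 'I_n.+1 => V (xpt R n i)) (ltn0Sn n) c).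
have W_last : W n <= (M + cB M) ^+ 2.
  have /andP[? ?] := V_bounds n (leqnn n); have /andP[? ?] := c_bounds.
  rewrite /W -(real_normK (num_real (_ - c))) lerXn2r ?nnegrE//.
    by apply: addr_ge0 => //; lra.
  by rewrite ler_norml; apply/andP; split; lra.
(* For x = V(x_i) - c and error e this is (2x + e)^2 >= 2x^2 - e^2, whose difference is 2(x +
   e)^2. *)
have mu_W (i : 'I_n) :
    2 * W i - (cL M Ch * z) ^+ 2 <= (mu i - average mu) ^+ 2.
  pose e := V (xpt R n i.+1) - V (xpt R n i) + (f (xpt R n i.+1) - f (xpt R n i)) ^+ 2.
  have e_le : e ^+ 2 <= (cL M Ch * z) ^+ 2.
    have i1 : `|i.+1%:R - i%:R : R| < n%:R * h.
      rewrite -natr1 addrC addKr normr1.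
      by apply: lt_le_trans (n_bandwidth_ge beta n0 Ch1); have := Ch2; lra.
    have := V_lip _ _ (ltn_ord i) (ltnW (ltn_ord i)) i1.
    have [d1 _] := delta_sqr_le a0 b1 n0 fH (ltn_ord i).
    have := sqr_ge0 (f (xpt R n i.+1) - f (xpt R n i)).
    have MC : 0 <= M * Ch * z by rewrite !mulr_ge0// ltW.
    have M2 : 0 <= M ^+ 2 * z by rewrite mulr_ge0 ?sqr_ge0// ltW.
    rewrite -(real_normK (num_real e)) /e.
    move: (_ ^+ 2) d1 => x x1 x0; rewrite -/z in x1.
    rewrite ler_norml => /andP[? ?].
    rewrite lerXn2r ?nnegrE//; first by rewrite /cL mulrDl addr_ge0// -mulrA mulr_ge0.
    by rewrite /cL ler_norml; apply/andP; split; lra.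
  have -> : mu i - average mu = 2 * (V (xpt R n i) - c) + e.
    have <- : 2 * c = average mu by rewrite /c mulrC divfK.
    by rewrite /mu (sq_meanE _ V_bounds)// /e; ring.
  rewrite /W; have := sqr_ge0 (2 * (V (xpt R n i) - c) + 2 * e).
  by move: (_ - c) => x; nra.
rewrite /sq_mean_var /emp_var -/mu ler_pdivlMl//.
apply: (@le_trans _ _ (\sum_(i < n) (2 * W i - (cL M Ch * z) ^+ 2))); last first.
  exact: ler_sum.
rewrite sumrB -mulr_sumr sumr_const card_ord -mulr_natl.
rewrite big_ord_recr/= -natr1 in W_total.
have N1 : 1 <= n%:R :> R by rewrite ler1n.
have nz : (M + cB M) ^+ 2 <= (M + cB M) ^+ 2 * (n%:R * z ^+ 2).
  rewrite -[leLHS]mulr1 ler_wpM2l ?sqr_ge0// mulrC -ler_pdivrMr// mul1r.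
  exact: invn_le_zeta2.
have Cz0 := sqr_ge0 (C * z).
have e1 : (C * z) ^+ 2 = C ^+ 2 * z ^+ 2 by rewrite exprMn.
have e2 : (cL M Ch * z) ^+ 2 = cL M Ch ^+ 2 * z ^+ 2 by rewrite exprMn.
rewrite e2; rewrite mulrDl mul1r e1 in W_total; rewrite e1 in Cz0; lra.
Qed.

(** Here v >= L z^2, so bias and threshold together use at most half of v. Chebyshev with deviation
    v / 2 then gains a factor 1/L from z^2 <= v / L. *)
Lemma type_II_error_le (C' L C : R) : 0 <= C -> 1 <= L -> 2 * (C1 + C') <= L ->
  L + 2 * (M + cB M) ^+ 2 + cL M Ch ^+ 2 <= 2 * C ^+ 2 ->
  D1 beta M n (C * z) V ->
  fine (P [set w | T w <= C' * z ^+ 2]) <= 4 * (C3 + C4) / L.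
Proof.
move=> C0 L1 LC' LC VD; have [VH [Vge0 _]] := VD.
have V_bounds := holder_bounds VH Vge0; have V_lip := holder_bandwidth_lip VH.
have v_lower := emp_var_lower C0 VD; set v := sq_mean_var n f V in v_lower.
have z2 : 0 < z ^+ 2 by rewrite exprn_gt0.
have L0 : 0 < L by exact: lt_le_trans ltr01 L1.
have v_ge : L * z ^+ 2 <= v.
  by apply: le_trans v_lower; rewrite ler_pM2r//; lra.
have v0 : 0 < v by apply: lt_le_trans v_ge; exact: mulr_gt0.
have := mean_That_bias kl0 klu hK M1 Ch2 Ch8 a0 b0 b1 n0 fH V_bounds V_lip.
have [LX mX] := That_noise_second_moment kl0 klu hK M1 Ch2 Ch8 a0 b0 b1 n0 fH
  V_bounds V_lip iid.
rewrite -/C1 -/C3 -/C4 -/v -/z in mX *; rewrite ler_norml => /andP[mb _].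
have tm : C' * z ^+ 2 <= mean_That Ch K beta n f V - v / 2.
  have := ler_wpM2r (ltW z2) LC'; lra.
have v20 : 0 < v / 2 by rewrite divr_gt0.
have := chebyshev_le LX v20 tm.
under [X in fine (P X) <= _ -> _]eq_set => w do rewrite -That_decomposition.
move=> H; apply: (le_trans H).
rewrite ler_pdivrMr ?exprn_gt0//; apply: (le_trans mX).
have C30 : 0 <= C3 by exact: cVar0_ge0.
have C40 : 0 <= C4 by exact: cVar1_ge0.
have -> : 4 * (C3 + C4) / L * (v / 2) ^+ 2 =
    C3 * (v ^+ 2 / L) + C4 * (v ^+ 2 / L) by field; rewrite gt_eqF.
have zv : z ^+ 2 * v <= v ^+ 2 / L.
  by rewrite ler_pdivlMr// mulrAC expr2 ler_pM2r// mulrC.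
have zz : z ^+ 4 <= z ^+ 2 * v.
  rewrite (_ : z ^+ 4 = z ^+ 2 * z ^+ 2); last by ring.
  rewrite ler_pM2l//; apply: le_trans v_ge.
  by rewrite -[leLHS]mul1r ler_pM2r.
rewrite -[_ * _ * v]mulrA lerD// ler_wpM2l//.
exact: le_trans zv.
Qed.
End error_bounds.

(** Weakening the moment bound to its absolute value makes the constants built from it
    nonnegative. *)
Lemma iid_noise_norm (R : realType) (Cxi : R) d (Om : measurableType d)
    (P : probability Om R) n (xi : 'I_n.+1 -> Om -> R) :
  iid_noise Cxi P xi -> iid_noise `|Cxi| P xi.
Proof.
move=> [? [? [? [m4 ?]]]]; split=> //; split=> //; split=> //; split=> //.
by apply: (le_trans m4); rewrite lee_fin ler_norm.
Qed.

Unset Implicit Arguments.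

Theorem theorem5p3 (R : realType) (Cxi kl ku : R) :
  0 < kl -> kl <= ku ->
  exists M0 Ch0 : R, forall (M Ch : R), M0 <= M -> Ch0 <= Ch ->
  forall K : R -> R, is_kernel kl ku K ->
  forall eta : R, 0 < eta < 1 ->
  exists C' Ceta : R, 0 < C' /\ 0 < Ceta /\
  forall C : R, Ceta < C ->
  forall alpha beta : R, 0 < alpha -> 0 < beta < 1 / 2 ->
  forall n : nat, (1 <= n)%N ->
  let zt := zeta alpha beta n in
  let h := bandwidth Ch beta n in
  forall (f0 V0 f1 V1 : R -> R),
    holder alpha M f0 -> D0 M n V0 ->
    holder alpha M f1 -> D1 beta M n (C * zt) V1 ->
  forall d0 (Om0 : measurableType d0) (P0 : probability Om0 R)
         (xi0 : 'I_n.+1 -> Om0 -> R), iid_noise Cxi P0 xi0 ->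
  forall d1 (Om1 : measurableType d1) (P1 : probability Om1 R)
         (xi1 : 'I_n.+1 -> Om1 -> R), iid_noise Cxi P1 xi1 ->
  fine (P0 [set w | C' * zt ^+ 2 < That K h n (Yobs f0 V0 xi0 w)])
  + fine (P1 [set w | That K h n (Yobs f1 V1 xi1 w) <= C' * zt ^+ 2])
  <= eta.
Proof.
(* The term 2 makes the bandwidth cover two grid steps, and 8 [ku] keeps the normaliser of the
   weights above 1/2. *)
move=> kl0 klu; exists 1, (2 + 8 * ku) => M Ch M1 ChB K hK eta /andP[eta0 eta1].
have ku0 : 0 < ku by exact: lt_le_trans klu.
have Ch2 : 2 <= Ch by lra.
have Ch8 : 8 * ku <= Ch by lra.
have Cxi0 : 0 <= `|Cxi| by [].
set C1 := cBias M Ch; set C3 := cVar0 `|Cxi| ku M Ch; set C4 := cVar1 `|Cxi| M.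
have C10 : 0 <= C1.
  by apply: addr_ge0; [apply: mulr_ge0; rewrite ?sqr_ge0//; lra|exact: sqr_ge0].
have C30 : 0 <= C3 by exact: (cVar0_ge0 M kl0 klu Ch2 Cxi0).
have C40 : 0 <= C4 by exact: cVar1_ge0.
have M4 : 0 <= M ^+ 4 by rewrite exprn_ge0//; lra.
set S := C3 + C4 * M ^+ 4.
have S0 : 0 <= S by rewrite addr_ge0// mulr_ge0.
have SE0 : 0 <= 2 * S / eta by rewrite divr_ge0 ?mulr_ge0// ltW.
(* Since X >= 1, also X^2 >= 2 S / [eta], so the first error S / X^2 is at most [eta] / 2. *)
pose X := 1 + 2 * S / eta.
have X1 : 1 <= X by rewrite lerDl.
pose C' := C1 + M ^+ 4 + X.
have QE0 : 0 <= 8 * (C3 + C4) / eta.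
  exact: divr_ge0 (mulr_ge0 (ler0n _ _) (addr_ge0 C30 C40)) (ltW eta0).
(* The summands serve in turn L >= 1, the room for bias and threshold, and a second error of at most
   [eta] / 2. *)
pose L := 1 + 2 * (C1 + C') + 8 * (C3 + C4) / eta.
have C'0 : 0 < C' by rewrite /C'; lra.
have L1 : 1 <= L by rewrite /L; lra.
have B2 := sqr_ge0 (M + cB M); have L2 := sqr_ge0 (cL M Ch).
(* The leading 1 gives C <= C^2, so the quadratic separation condition follows from this linear
   one. *)
pose Ceta := 1 + L + 2 * (M + cB M) ^+ 2 + cL M Ch ^+ 2.
exists C', Ceta; split=> //; split; first by rewrite /Ceta; lra.
move=> C CetaC alpha beta a0 /andP[b0 b1] n n0 zt h f0 V0 f1 V1 fH0 VD0 fH1 VD1.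
move=> d0 Om0 P0 xi0 /iid_noise_norm iid0 d1 Om1 P1 xi1 /iid_noise_norm iid1.
have C1' : 1 <= C by move: CetaC; rewrite /Ceta; lra.
have e0 : fine (P0 [set w | C' * zt ^+ 2 < That K h n (Yobs f0 V0 xi0 w)]) <= eta / 2.
  have X0 : 0 < X by lra.
  apply: (le_trans (type_I_error_le kl0 klu hK M1 Ch2 Ch8 Cxi0 a0 b0 b1 n0 fH0
    iid0 X0 VD0)).
  rewrite ler_pdivrMr ?exprn_gt0// -/C3 -/C4 -/S.
  have SX : 2 * S / eta <= X ^+ 2.
    by apply: (@le_trans _ _ X); [rewrite /X lerDr|rewrite expr2 ler_peMl// ltW].
  by move: SX; rewrite ler_pdivrMr//; lra.
have e1 : fine (P1 [set w | That K h n (Yobs f1 V1 xi1 w) <= C' * zt ^+ 2]) <= eta / 2.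
  have C0 : 0 <= C by lra.
  have LC' : 2 * (C1 + C') <= L by rewrite /L; lra.
  have LC : L + 2 * (M + cB M) ^+ 2 + cL M Ch ^+ 2 <= 2 * C ^+ 2.
    have : C <= C ^+ 2 by rewrite expr2 ler_peMl.
    by move: CetaC; rewrite /Ceta; lra.
  apply: (le_trans (type_II_error_le kl0 klu hK M1 Ch2 Ch8 Cxi0 a0 b0 b1 n0 fH1
    iid1 C0 L1 LC' LC VD1)).
  rewrite ler_pdivrMr ?(lt_le_trans ltr01 L1)// -/C3 -/C4.
  have QL : 8 * (C3 + C4) / eta <= L by rewrite /L; lra.
  by move: QL; rewrite ler_pdivrMr//; lra.
lra.
Qed.
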